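(* Let $n\geq 2$, $\lambda>0$, $\rho>1$, and let $X_1,\ldots,X_n$ be i.i.d. $\mathrm{Exp}(\lambda)$ (density $\lambda e^{-\lambda x}$ on $(0,\infty)$). Let $X_{(1)}\le\cdots\le X_{(n)}$ be the order statistics and \[M_n\coloneqq\frac{\log X_{(n)}-\log X_{(1)}}{\log\rho}+1 .\] Then for $\mu>1$ and $0<q<1$, \begin{align*} F_{M_n}(\mu)&=(n-1)\,B\!\left(\frac{\rho^{\mu-1}+n-1}{\rho^{\mu-1}-1},\,n-1\right),\\ f_{M_n}(\mu)&=\frac{n\rho^{\mu-1}F_{M_n}(\mu)\log\rho}{(\rho^{\mu-1}-1)^2}\left\{\psi\!\left(\frac{n\rho^{\mu-1}}{\rho^{\mu-1}-1}\right)-\psi\!\left(\frac{\rho^{\mu-1}+n-1}{\rho^{\mu-1}-1}\right)\right\},\\ F_{M_n}^{-1}(q)&\sim\log_\rho\!\left(\frac{n\log(n-1)+\log(1/q)}{\log(1/q)}\right)+1\sim\log_\rho n-\log_\rho(-\log q), \end{align*} where the asymptotic results in the last line hold as either or both $n\to\infty$ and $q\to1^-$, and the first asymptotic equivalence in the last line also holds as $q\to0^+$ with $n$ fixed.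
   Context: $F_{M_n}$, $f_{M_n}$, $F_{M_n}^{-1}$ denote the CDF, density and quantile function of $M_n$. $B(x,y)=\int_0^1 t^{x-1}(1-t)^{y-1}dt$ is the Beta function and $\psi=(\log\Gamma)'$ is the digamma function. $a\sim b$ means the ratio tends to $1$ in the stated limit.
   Formalization: As q→1⁻ with n fixed, the first asymptotic equivalence is stated only for n≥3: for n=2, log(n−1)=0 makes the middle expression identically 1 while the quantile tends to infinity; the quantile's equivalence to the last expression is kept for n=2. *)

(* Defs.v *)
From HB Require Import structures.
From mathcomp Require Import all_boot all_order all_algebra.
From mathcomp Require Import all_classical all_reals all_analysis.
From mathcomp Require Import exponential_distribution.
Set Implicit Arguments. Unset Strict Implicit. Unset Printing Implicit Defensive.
Import Order.TTheory GRing.Theory Num.Theory.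
Import numFieldNormedType.Exports.
Local Open Scope classical_set_scope.
Local Open Scope ring_scope.

Section defs.
Context {R : realType}.

Definition Beta (x y : R) : R :=
  Rintegral lebesgue_measure `]0, 1[%classic
    (fun t => t `^ (x - 1) * (1 - t) `^ (y - 1)).

Definition Gamma (x : R) : R :=
  Rintegral lebesgue_measure `]0, +oo[%classic
    (fun t => t `^ (x - 1) * expR (- t)).

Definition digamma (x : R) : R := derive1 (fun y => ln (Gamma y)) x.

Definition logb (rho x : R) : R := ln x / ln rho.

Definition asym_eq {U : Type} (F : set_system U) (a b : U -> R) : Prop :=
  (fun u => a u / b u) @ F --> (1 : R).

End defs.

Section prob.
Context {R : realType} {d : measure_display} {T : measurableType d}.
Variable P : probability T R.

Definition mutually_independent (X : nat -> {RV P >-> R}) : Prop :=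
  forall (s : seq nat) (B : nat -> set R), uniq s ->
    (forall i, measurable (B i)) ->
    fine (P (\big[setI/setT]_(i <- s) (X i @^-1` B i))) =
    \prod_(i <- s) fine (P (X i @^-1` B i)).

Definition exp_distributed (X : nat -> {RV P >-> R}) (lam : R) : Prop :=
  forall i (A : set R), measurable A ->
    distribution P (X i) A = exponential_prob lam A.

Definition iid_exp (X : nat -> {RV P >-> R}) (lam : R) : Prop :=
  mutually_independent X /\ exp_distributed X lam.

Definition ord_max (X : nat -> {RV P >-> R}) (n : nat) (w : T) : R :=
  \big[Order.max/X 0%N w]_(i < n) X i w.
Definition ord_min (X : nat -> {RV P >-> R}) (n : nat) (w : T) : R :=
  \big[Order.min/X 0%N w]_(i < n) X i w.

Definition Mn (X : nat -> {RV P >-> R}) (rho : R) (n : nat) (w : T) : R :=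
  (ln (ord_max X n w) - ln (ord_min X n w)) / ln rho + 1.

Definition cdfM (X : nat -> {RV P >-> R}) (rho : R) (n : nat) (x : R) : R :=
  fine (P [set w | Mn X rho n w <= x]).

Definition quantM (X : nat -> {RV P >-> R}) (rho : R) (n : nat) (q : R) : R :=
  inf [set x | q <= cdfM X rho n x].

End prob.

Definition approxA {R : realType} (rho : R) (n : nat) (q : R) : R :=
  logb rho ((n%:R * ln (n%:R - 1) + ln q^-1) / ln q^-1) + 1.
Definition approxB {R : realType} (rho : R) (n : nat) (q : R) : R :=
  logb rho n%:R - logb rho (- ln q).

(* Main.v *)
Require Import Defs.
From HB Require Import structures.
From mathcomp Require Import all_boot all_order all_algebra.
From mathcomp Require Import all_classical all_reals all_analysis.
From mathcomp Require Import exponential_distribution.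
From mathcomp Require Import measurable_realfun ring lra.
Import Order.TTheory GRing.Theory Num.Theory.
Import numFieldNormedType.Exports.
Local Open Scope classical_set_scope.
Local Open Scope ring_scope.

(* With [U_i = exp (- lam X_i)], i.i.d. uniform on (0, 1), and
   [r = rho^(mu - 1)], the event [M_n <= mu] is [min U >= (max U)^r].  The
   probability of this event together with [max U < u] has derivative
   [n (u - u^r)^(n-1)] in [u]; integrating from 0 to 1 gives
   [F(mu) = prod_(1 <= k < n) k / (k + a)] with [a = n / (r - 1)], which is the
   Beta value of the statement.  Its logarithmic derivative in [a] is minus the
   sum of the [1 / (k + a)], a difference of digamma values.

   The quantile at [q] is [1 + log_rho (1 + n / a)], where [a] solves
   [sum_(1 <= k < n) ln (1 + a / k) = L := - ln q].  As
   [L / (1 + ln n) <= a <= e^L - 1], its product with [ln rho] differs from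
   [ln (n / L)] by at most [O(1) + ln (O(1) + ln n)] while [L] is bounded, and
   the same holds for both approximations. *)

(** The law of the sample enters only through the probabilities of boxes, which independence gives
    directly; this is why the derivative in [u] is obtained by bracketing increments, and no
    [n]-fold integral appears. As the second Beta argument is an integer, the integrand has an
    elementary primitive, and one recursion serves both the range probability and the Beta function.
    The digamma arguments are [a + 1] and [a + n], both above 1. So the recurrences for [Gamma] and
    [digamma] are proved for [x > 1], where the integrand of [Gamma] stays bounded near 0. When [q]
    tends to [0^+], [L] is unbounded and the comparison with [ln (n / L)] breaks down; there both
    sides of the equivalence tend to 1. *)

Lemma ln_le_sub1 {R : realType} (x : R) : 0 < x -> ln x <= x - 1.
Proof.
by move=> x0; have := expR_ge1Dx (ln x); rewrite lnK ?posrE// lerBrDl.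
Qed.

Lemma powR_sub1_gt1 {R : realType} (rho m : R) :
  1 < rho -> 1 < m -> 1 < rho `^ (m - 1).
Proof.
move=> rho1 m1; rewrite /powR gt_eqF ?(lt_trans ltr01)// -[ltLHS]expR0 ltr_expR.
by rewrite mulr_gt0// ?subr_gt0// ln_gt0.
Qed.

(** * Primitives of t^c (1 - t^s)^m and the Beta function *)

(** The recursion splits off one factor [1 - t^s] of [t^c (1 - t^s)^m], which avoids the binomial
    expansion; the exponent [c] has to vary. *)
Fixpoint powR_primitive {R : realType} (s c : R) (m : nat) (t : R) : R :=
  if m is m'.+1 then powR_primitive s c m' t - powR_primitive s (c + s) m' t
  else t `^ (c + 1) / (c + 1).

Section powR_primitive_theory.
Context {R : realType}.
Implicit Types s c t : R.

Lemma is_derive_powR_primitive s c m t : 0 < t -> 0 <= s -> 0 < c + 1 ->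
  is_derive t 1 (powR_primitive s c m) (t `^ c * (1 - t `^ s) ^+ m).
Proof.
move=> t0 s0; elim: m c => [|m IH] c c1 /=.
  have h : is_derive t 1 ((c + 1)^-1 \*: (fun x : R => x `^ (c + 1)))
      ((c + 1)^-1 *: ((c + 1) * t `^ (c + 1 - 1))).
    by apply: is_deriveZ; apply: is_derive1_powR.
  have -> : (fun t => t `^ (c + 1) / (c + 1)) =
            (c + 1)^-1 \*: (fun x : R => x `^ (c + 1)).
    by apply/funext => x /=; rewrite mulrC.
  apply: (is_derive_eq h).
  by rewrite addrK expr0 mulr1 /GRing.scale/= mulrA mulVf ?mul1r// gt_eqF.
have c1' : 0 < c + s + 1 by rewrite addrAC ltr_wpDr.
have h := is_deriveB (IH _ c1) (IH _ c1').
apply: (is_derive_eq h).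
rewrite powRD ?(gt_eqF t0) ?implybT// exprS; ring.
Qed.

Lemma powR_primitive0 s c m : 0 <= s -> 0 < c + 1 -> powR_primitive s c m 0 = 0.
Proof.
move=> s0; elim: m c => [|m IH] c c1 /=; first by rewrite powR0 ?mul0r// gt_eqF.
by rewrite !IH ?subrr// addrAC ltr_wpDr.
Qed.

Lemma powR_primitive_cvg0 s c m : 0 <= s -> 0 < c + 1 ->
  powR_primitive s c m t @[t --> 0^'+] --> (0 : R).
Proof.
move=> s0; elim: m c => [|m IH] c c1 /=.
  by rewrite -[X in _ --> X](mul0r (c + 1)^-1); apply: cvgMl; exact: powR_cvg0.
by rewrite -[X in _ --> X](subrr 0); apply: cvgB; apply: IH; rewrite // addrAC ltr_wpDr.
Qed.

(** The two terms of the recursion have denominators that share all factors but the first and the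
    last; these differ by [(m + 1) s], which supplies the new factors of [m! s^m]. *)
Lemma powR_primitive1 s c m : 0 <= s -> 0 < c + 1 ->
  powR_primitive s c m 1 = m`!%:R * s ^+ m / \prod_(j < m.+1) (c + 1 + j%:R * s).
Proof.
move=> s0; elim: m c => [|m IH] c c1 /=.
  by rewrite powR1 big_ord_recl big_ord0/= mul0r addr0 mulr1 fact0 expr0 mulr1.
have pos (j : nat) : c + 1 + j%:R * s != 0.
  by rewrite gt_eqF// ltr_wpDr// mulr_ge0.
rewrite !IH//; last by rewrite addrAC ltr_wpDr.
pose p := \prod_(j < m.+1) (c + 1 + (j.+1)%:R * s).
have p2 : p = \prod_(j < m) (c + 1 + (j.+1)%:R * s) * (c + 1 + m.+1%:R * s).
  by rewrite /p big_ord_recr.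
have p0 : p != 0 by apply/prodf_neq0 => i _; exact: pos.
have -> : \prod_(j < m.+1) (c + s + 1 + j%:R * s) = p.
  by apply: eq_bigr => i _; rewrite -natr1; ring.
have -> : \prod_(j < m.+2) (c + 1 + j%:R * s) = (c + 1) * p.
  by rewrite big_ord_recl/= mul0r addr0.
have -> : \prod_(j < m.+1) (c + 1 + j%:R * s) =
    (c + 1) * \prod_(j < m) (c + 1 + (j.+1)%:R * s).
  by rewrite big_ord_recl/= mul0r addr0.
have q0 : \prod_(j < m) (c + 1 + (j.+1)%:R * s) != 0.
  by apply/prodf_neq0 => i _; exact: pos.
move: (pos m.+1) (pos 0%N); rewrite mul0r addr0 p2 factS natrM exprS -natr1 => h1 h2.
by field; rewrite q0 h1 h2.
Qed.

End powR_primitive_theory.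

(** For [c > 0] the integrand is continuous on all of [[0, 1]], so the fundamental theorem of
    calculus applies with the primitive at [s = 1]. *)
Lemma Beta_natr {R : realType} (c : R) (m : nat) : 0 < c ->
  Beta (c + 1) m.+1%:R = m`!%:R / \prod_(j < m.+1) (c + 1 + j%:R).
Proof.
move=> c0.
have c1 : 0 < c + 1 by rewrite addr_gt0.
have cvgf0 : (t `^ c * (1 - t) ^+ m) @[t --> 0^'+] --> (0 : R).
  rewrite -[X in _ --> X](mul0r ((1 - 0) ^+ m)); apply: cvgM; first exact: powR_cvg0.
  apply: cvg_at_right_filter.
  exact: (@continuous_comp _ _ _ (fun t : R => 1 - t) (fun t : R => t ^+ m) 0
    (cvgB (cvg_cst _) cvg_id) (@exprn_continuous R m _)).
have dcont (t : R) : 0 < t -> {for t, continuous (fun t => t `^ c * (1 - t) ^+ m)}.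
  move=> t0; apply: (@cvgM R R); last first.
    exact: (@continuous_comp _ _ _ (fun t : R => 1 - t) (fun t : R => t ^+ m) t
      (cvgB (cvg_cst _) cvg_id) (@exprn_continuous R m _)).
  apply: (@differentiable_continuous _ _ _ _ (fun t => t `^ c)); apply/derivable1_diffP.
  by apply: derivable_powR; rewrite in_itv/= andbT.
have contf : {within `[0, 1], continuous (fun t : R => t `^ c * (1 - t) ^+ m)}.
  apply/continuous_within_itvP => //; split.
  - by move=> t /[!in_itv]/= /andP[t0 _]; exact: dcont.
  - by rewrite powR0 ?gt_eqF// mul0r.
  - by apply: cvg_at_left_filter; exact: dcont.
transitivity (\int[lebesgue_measure]_(t in `]0, 1[) (t `^ c * (1 - t) ^+ m)).
  apply: eq_Rintegral => t /[!inE]/= /[!in_itv]/= /andP[t0 t1].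
  by rewrite addrK -natr1 addrK powR_mulrn// subr_ge0 ltW.
have intf : lebesgue_measure.-integrable `[0, 1]
   (EFin \o (fun t : R => t `^ c * (1 - t) ^+ m)).
  by apply: continuous_compact_integrable => //; exact: segment_compact.
rewrite Rintegral_itv_bndo_bndc; last by apply: integrableS intf => //; exact: subset_itv_oo_cc.
rewrite Rintegral_itv_obnd_cbnd; last by apply: integrableS intf => //; exact: subset_itv_oc_cc.
rewrite /Rintegral (@continuous_FTC2 _ _ (powR_primitive 1 c m))//.
- rewrite -EFinB/= powR_primitive0// subr0 powR_primitive1// expr1n mulr1.
  by congr (_ / _); apply: eq_bigr => i _; rewrite mulr1.
- split.
  + move=> t /[!in_itv]/= /andP[t0 _]; apply: ex_derive.
    exact: is_derive_powR_primitive.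
  + by rewrite powR_primitive0//; exact: powR_primitive_cvg0.
  + apply: cvg_at_left_filter.
    apply: (@differentiable_continuous _ _ _ _ (powR_primitive 1 c m)).
    by apply/derivable1_diffP; apply: ex_derive; exact: is_derive_powR_primitive.
- move=> t /[!in_itv]/= /andP[t0 _]; rewrite derive1E.
  have [_ ->] := is_derive_powR_primitive 1 c m t t0 ler01 c1.
  by rewrite powRr1// ltW.
Qed.

(** * The Gamma and digamma functions *)

Section gamma_integrand.
Context {R : realType}.
Implicit Types x s t u v : R.

(** The maximum of [t^s e^(-t/2)] over [t > 0], reached at [t = 2 s]. *)
Let C s : R := expR (s * ln (2 * s) - s).

(* From [ln y <= y - 1] at [y = t / (2 s)]. *)
Lemma powR_le_expR_half s t : 0 < s -> 0 < t -> t `^ s <= C s * expR (t / 2).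
Proof.
move=> s0 t0; rewrite /C /powR gt_eqF// -expRD ler_expR.
have s20 : 0 < 2 * s by rewrite mulr_gt0.
have := expR_ge1Dx (ln (t / (2 * s))).
rewrite lnK ?posrE ?divr_gt0// ln_div ?posrE// -(ler_pM2l s0).
have -> : s * (t / (2 * s)) = t / 2 by field; rewrite gt_eqF.
lra.
Qed.

Lemma powR_expR_le s t : 0 < s -> 0 < t ->
  t `^ s * expR (- t) <= C s * expR (- (t / 2)).
Proof.
move=> s0 t0; have -> : expR (- (t / 2)) = expR (t / 2) * expR (- t).
  by rewrite -expRD; congr expR; lra.
by rewrite mulrA ler_wpM2r ?expR_ge0// powR_le_expR_half.
Qed.

(** A bound uniform in [s] between [d] and [b], to differentiate [Gamma] under the integral. For
    [t >= 1], [ln t <= t] raises the exponent to at most [b + 1]; for [t < 1], [ln y < y] at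
    [y = t^-d] gives [|ln t| t^d <= 1 / d]. *)
Lemma normr_ln_powR_expR_le (d s b t : R) : 0 < d -> d <= s -> s <= b -> 0 < t ->
  `|ln t * (t `^ s * expR (- t))| <= (d^-1 + C (b + 1)) * expR (- (t / 2)).
Proof.
move=> d0 ds sb t0.
have s0 : 0 < s by apply: lt_le_trans ds.
rewrite normrM [X in _ * X]ger0_norm ?mulr_ge0 ?powR_ge0 ?expR_ge0//.
rewrite mulrDl.
have [t1|t1] := leP 1 t.
  apply: ler_wpDl; first by rewrite mulr_ge0 ?expR_ge0// invr_ge0 ltW.
  rewrite ger0_norm ?ln_ge0//.
  apply: le_trans (powR_expR_le (b + 1) t _ t0); last first.
    by rewrite addr_gt0// (lt_le_trans s0).
  rewrite mulrA ler_wpM2r ?expR_ge0// addrC powRD; last by rewrite (gt_eqF t0) implybT.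
  rewrite powRr1 ?(ltW t0)// ler_pM ?ln_ge0 ?powR_ge0//; first exact/ltW/ln_sublinear.
  exact: ler_powR.
apply: ler_wpDr; first by rewrite mulr_ge0 ?expR_ge0.
rewrite ltr0_norm ?ln_lt0 ?t0// mulrA ler_pM ?mulr_ge0 ?powR_ge0 ?expR_ge0//.
- by rewrite oppr_ge0 ltW// ln_lt0// t0.
- rewrite -(ler_pM2l d0) mulfV ?gt_eqF//.
  apply: (@le_trans _ _ (t `^ (- d) * t `^ s)).
    rewrite mulrA ler_wpM2r ?powR_ge0//.
    have := @ln_sublinear R (t `^ (- d)) (powR_gt0 _ t0).
    by rewrite ln_powR => /ltW; rewrite mulNr mulrN.
  rewrite -powRD; last by rewrite (gt_eqF t0) implybT.
  rewrite -[leRHS](powRr0 t) ger_powR ?t0 ?(ltW t1)//.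
  by rewrite addrC subr_ge0.
- by rewrite ler_expR; lra.
Qed.

Lemma integrable_expR_half :
  lebesgue_measure.-integrable `]0, +oo[ (EFin \o (fun t => expR (- (t / 2)))).
Proof.
have h : lebesgue_measure.-integrable `]0, +oo[ (EFin \o exponential_pdf (2^-1 : R)).
  apply: (@integrableS _ _ _ _ setT) => //.
  by apply: integrable_exponential_pdf; rewrite invr_gt0.
have {}h : lebesgue_measure.-integrable `]0, +oo[
    (fun t => (2 : R)%:E * (exponential_pdf (2^-1 : R) t)%:E)%E.
  exact: integrableZl.
apply: eq_integrable h => //.
move=> t /[!inE]/= /[!in_itv]/= /[!andbT] t0.
rewrite exponential_pdfE ?(ltW t0)// -EFinM mulrA mulfV// mul1r.
by congr (expR _)%:E; lra.
Qed.

Lemma measurable_powR_expR s (D : set R) :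
  measurable_fun D (fun t => t `^ s * expR (- t)).
Proof.
apply: measurable_funTS; apply: measurable_funM => //.
by apply: measurableT_comp => //.
Qed.

Lemma integrable_powR_expR s : 0 < s ->
  lebesgue_measure.-integrable `]0, +oo[ (EFin \o (fun t => t `^ s * expR (- t))).
Proof.
move=> s0.
have h : lebesgue_measure.-integrable `]0, +oo[
    (fun t => (C s)%:E * (expR (- (t / 2)))%:E)%E.
  by apply: integrableZl => //; exact: integrable_expR_half.
apply: le_integrable h => //.
  by apply/measurable_EFinP; exact: measurable_powR_expR.
move=> t /=; rewrite in_itv/= andbT => t0.
rewrite lee_fin !ger0_norm ?mulr_ge0 ?powR_ge0 ?expR_ge0//.
exact: powR_expR_le.
Qed.

(** On [[1, 2]] the integrand is at least [e^-2]. Positivity is what makes [ln (Gamma x)]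
    differentiable. *)
Lemma Gamma_gt0 x : 1 < x -> 0 < Gamma x.
Proof.
move=> x1; have x10 : 0 < x - 1 by rewrite subr_gt0.
have h := integrable_powR_expR (x - 1) x10.
pose D : set R := `]0, +oo[%classic; pose E : set R := `[1, 2]%classic.
have sub : E `<=` D.
  by move=> t; rewrite /E/D/= !in_itv/= => /andP[t1 _]; rewrite (lt_le_trans ltr01).
pose f t := (t `^ (x - 1) * expR (- t))%:E.
have mf A : measurable_fun A f.
  by apply/measurable_EFinP; exact: measurable_powR_expR.
have f0 t : (0 <= f t)%E by rewrite lee_fin mulr_ge0 ?powR_ge0 ?expR_ge0.
suff : ((expR (- 2%:R : R))%:E <= \int[lebesgue_measure]_(t in D) f t)%E.
  rewrite -[X in (_ <= X)%E]fineK; last exact: (integrable_fin_num _ h).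
  by rewrite lee_fin; apply: lt_le_trans; exact: expR_gt0.
have mE : measurable E by exact: measurable_itv.
suff : ((expR (- 2%:R : R))%:E <= \int[lebesgue_measure]_(t in E) f t)%E.
  move/le_trans; apply; apply: ge0_subset_integral => //; [exact: measurable_itv|exact: mf].
apply: (@le_trans _ _ (\int[lebesgue_measure]_(t in E) (expR (- 2%:R : R))%:E)%E).
  have muE : lebesgue_measure E = 1%E.
    rewrite /E lebesgue_measure_itv/= lte_fin ltr1n -EFinD; congr EFin; lra.
  rewrite integral_cst//.
  set m := (X in (_ <= _ * X)%E); rewrite (_ : m = 1%E) ?mule1//.
apply: ge0_le_integral => //=.
- exact: mf.
- move=> t; rewrite /E/= in_itv/= => /andP[t1 t2]; rewrite lee_fin.
  rewrite -[leLHS]mul1r; apply: ler_pM; rewrite ?expR_ge0 ?ler_expR ?lerN2//.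
  by have := @ler_powR _ t t1 _ _ (ltW x10); rewrite powRr0.
Qed.

Lemma is_derive_powRr t x : 0 < t -> is_derive x 1 (fun y => t `^ y) (ln t * t `^ x).
Proof.
move=> t0.
have -> : (fun y => t `^ y) = expR \o (fun y => y * ln t).
  by apply/funext => y; rewrite /powR gt_eqF.
have h : is_derive x 1 (fun y => y * ln t) (ln t).
  have -> : (fun y => y * ln t) = ln t \*: (id : R -> R).
    by apply/funext => y /=; rewrite mulrC.
  by apply: (is_derive_eq (is_deriveZ _ _)); rewrite /GRing.scale/= mulr1.
apply: (is_derive_eq (is_derive1_comp _ h)).
by rewrite /powR gt_eqF//= mulrC.
Qed.

Lemma is_derive_gamma_integrand t x : 0 < t ->
  is_derive x 1 (fun y => t `^ (y - 1) * expR (- t))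
    (ln t * (t `^ (x - 1) * expR (- t))).
Proof.
move=> t0.
have -> : (fun y => t `^ (y - 1) * expR (- t)) =
    (expR (- t) / t) \*: (fun y => t `^ y).
  apply/funext => y /=; rewrite /GRing.scale/= powRB; last by rewrite (gt_eqF t0) implybT.
  by rewrite powRr1 ?ltW//; ring.
apply: (is_derive_eq (is_deriveZ _ (is_derive_powRr t x t0))).
rewrite /GRing.scale/= powRB; last by rewrite (gt_eqF t0) implybT.
by rewrite powRr1 ?ltW//; ring.
Qed.

Lemma derivable_Gamma x : 1 < x -> derivable Gamma x 1.
Proof.
move=> x1.
(* A neighbourhood of [x] that stays away from 1, so that the exponents [y - 1] are at least
   [d > 0]. *)
pose u : R := (1 + x) / 2; pose v := x + 1; pose d := u - 1.
have d0 : 0 < d by rewrite /d /u; lra.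
have Iu y : `]u, v[%classic y -> 0 < y - 1 /\ d <= y - 1 <= x.
  by rewrite /= in_itv/= /d /u /v => /andP[? ?]; split; [|apply/andP; split]; lra.
apply: (@derivable_under_integral R _ _ lebesgue_measure
  (fun y t => t `^ (y - 1) * expR (- t)) `]0, +oo[ _ x u v _ _ _
  (fun t => (d^-1 + C (x + 1)) * expR (- (t / 2)))).
- exact: measurable_itv.
- by rewrite /= in_itv/= /u /v; apply/andP; split; lra.
- by move=> y /Iu[y0 _]; exact: integrable_powR_expR.
- move=> y t _ /=; rewrite in_itv/= andbT => t0.
  by apply: ex_derive; exact: is_derive_gamma_integrand.
- by move=> t; rewrite mulr_ge0 ?expR_ge0// addr_ge0 ?expR_ge0// invr_ge0 ltW.
- have h : lebesgue_measure.-integrable `]0, +oo[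
      (fun t => (d^-1 + C (x + 1))%:E * (expR (- (t / 2)))%:E)%E.
    by apply: integrableZl => //; exact: integrable_expR_half.
  exact: h.
- move=> y t /Iu[y0 /andP[dy yx]] /=; rewrite in_itv/= andbT => t0.
  rewrite partial1of2E.
  have [_ ->] := is_derive_gamma_integrand t y t0.
  exact: normr_ln_powR_expR_le.
Qed.

Lemma cvg_expR_half : expR (- (t / 2)) @[t --> +oo] --> (0 : R).
Proof.
apply: (@cvg_comp _ _ _ (fun t => t / 2) (fun t => expR (- t)) _ (pinfty_nbhs R)).
  by apply: gt0_cvgMly; rewrite ?invr_gt0.
exact: cvgr_expR.
Qed.

Lemma cvg_powR_expR s : 0 < s -> t `^ s * expR (- t) @[t --> +oo] --> (0 : R).
Proof.
move=> s0; apply: (@squeeze_cvgr _ _ _ _ (cst 0) (fun t => C s * expR (- (t / 2)))).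
- near=> t; rewrite /= mulr_ge0 ?powR_ge0 ?expR_ge0//=.
  by apply: powR_expR_le => //; near: t; exact: nbhs_pinfty_gt.
- exact: cvg_cst.
- by rewrite -[X in _ --> X](mulr0 (C s)); apply: cvgMr; exact: cvg_expR_half.
Unshelve. all: by end_near. Qed.

Lemma cvg_powR_expR0 s : 0 < s -> t `^ s * expR (- t) @[t --> 0^'+] --> (0 : R).
Proof.
move=> s0; rewrite -[X in _ --> X](mul0r (expR (- 0))); apply: cvgM; first exact: powR_cvg0.
apply: cvg_at_right_filter; apply: (@continuous_comp _ _ _ (fun t => - t) expR).
  exact: opp_continuous.
exact: continuous_expR.
Qed.

Lemma is_derive_expR_half t :
  is_derive t 1 (fun t => expR (- (t / 2))) (- (expR (- (t / 2)) / 2)).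
Proof.
have h : is_derive t 1 (fun t : R => - (t / 2)) (- 2^-1).
  have -> : (fun t : R => - (t / 2)) = (- 2^-1) \*: (id : R -> R).
    by apply/funext => y /=; rewrite /GRing.scale/= mulNr mulrC.
  by apply: (is_derive_eq (is_deriveZ _ _)); rewrite /GRing.scale/= mulr1.
by apply: (is_derive_eq (is_derive1_comp _ h)); rewrite mulrN.
Qed.

Lemma is_derive_powR_expR s t : 0 < t ->
  is_derive t 1 (fun t => t `^ s * expR (- t))
    (s * (t `^ (s - 1) * expR (- t)) - t `^ s * expR (- t)).
Proof.
move=> t0.
have h : is_derive t 1 (fun t : R => expR (- t)) (- expR (- t)).
  have h : is_derive t 1 (fun t : R => - t) (- 1) by apply: is_deriveNid.
  by apply: (is_derive_eq (is_derive1_comp _ h)); rewrite mulrN1.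
apply: (is_derive_eq (is_deriveM (is_derive1_powR s t0) h)).
by rewrite /GRing.scale/=; ring.
Qed.

(* The integrand of [x Gamma(x) - Gamma(x + 1)] is the derivative of
   [t^x e^-t]; adding [C e^(-t/2)] makes it nonnegative, as required by the
   improper fundamental theorem of calculus. *)
Lemma GammaS x : 1 < x -> Gamma (x + 1) = x * Gamma x.
Proof.
move=> x1; have x10 : 0 < x - 1 by rewrite subr_gt0.
have x0 : 0 < x by apply: lt_trans x1.
pose c := C x.
have c0 : 0 < c by exact: expR_gt0.
pose g0 t : R := t `^ (x - 1) * expR (- t).
pose g1 t : R := t `^ x * expR (- t).
pose e t : R := expR (- (t / 2)).
pose D : set R := `]0, +oo[%classic.
have mD : measurable D by exact: measurable_itv.
have i0 : lebesgue_measure.-integrable D (EFin \o g0) by exact: integrable_powR_expR.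
have i1 : lebesgue_measure.-integrable D (EFin \o g1) by exact: integrable_powR_expR.
have ie : lebesgue_measure.-integrable D (EFin \o e) by exact: integrable_expR_half.
have xi0 : lebesgue_measure.-integrable D (EFin \o (fun t => x * g0 t)).
  have h : lebesgue_measure.-integrable D (fun t => x%:E * (g0 t)%:E)%E by exact: integrableZl.
  exact: h.
have ci : lebesgue_measure.-integrable D (EFin \o (fun t => c * e t)).
  have h : lebesgue_measure.-integrable D (fun t => c%:E * (e t)%:E)%E by exact: integrableZl.
  exact: h.
have i01 : lebesgue_measure.-integrable D (EFin \o (fun t => x * g0 t - g1 t)).
  have h : lebesgue_measure.-integrable D (fun t => (x * g0 t)%:E - (g1 t)%:E)%E.
    exact: integrableB.
  exact: h.
have i01c : lebesgue_measure.-integrable D (EFin \o (fun t => x * g0 t - g1 t + c * e t)).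
  have h : lebesgue_measure.-integrable D
      (fun t => (x * g0 t - g1 t)%:E + (c * e t)%:E)%E.
    exact: integrableD.
  exact: h.
have econt : continuous e.
  move=> t; apply: (@differentiable_continuous _ _ _ _ e); apply/derivable1_diffP.
  by apply: ex_derive; exact: is_derive_expR_half.
have gcont s t : 0 < t -> {for t, continuous (fun t => t `^ s * expR (- t))}.
  move=> t0.
  apply: (@differentiable_continuous _ _ _ _ (fun t => t `^ s * expR (- t))).
  by apply/derivable1_diffP; apply: ex_derive; exact: is_derive_powR_expR.
have de t : is_derive t 1 (fun t => - 2 * c * e t) (c * e t).
  apply: (is_derive_eq (is_deriveZ (- 2 * c) (is_derive_expR_half t))).
  by rewrite /GRing.scale/= /e; field.
have He : \int[lebesgue_measure]_(t in D) (c * e t) = 2 * c.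
  rewrite Rintegral_itv_obnd_cbnd//.
  rewrite (@Rintegral_ge0_continuous_FTC2y _ _ (fun t => (- 2 * c) * e t) 0 0).
  - by rewrite /e mul0r oppr0 expR0; ring.
  - by move=> t _; rewrite mulr_ge0 ?expR_ge0 ?(ltW c0).
  - by apply: continuous_subspaceT => t; apply: cvgMr; exact: econt.
  - by rewrite -[X in _ --> X](mulr0 (- 2 * c)); apply: cvgMr; exact: cvg_expR_half.
  - by move=> t _; apply: ex_derive; exact: de.
  - by apply: cvg_at_right_filter; apply: cvgMr; exact: econt.
  - move=> t _; rewrite derive1E.
    by have [_ ->] := de t.
(* The part [t^x e^-t] of the primitive vanishes at both ends, so only the integral of the added
   term remains. *)
have Hs : \int[lebesgue_measure]_(t in D) (x * g0 t - g1 t + c * e t) = 2 * c.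
  rewrite Rintegral_itv_obnd_cbnd//.
  rewrite (@Rintegral_ge0_continuous_FTC2y _ _ (fun t => g1 t + (- 2 * c) * e t) 0 0).
  - by rewrite /g1 /e mul0r oppr0 expR0 powR0 ?gt_eqF//; ring.
  - move=> t; rewrite le_eqVlt => /predU1P[<-|t0].
      rewrite /g0/g1 !powR0 ?gt_eqF// !mul0r mulr0 subrr add0r.
      by rewrite mulr_ge0 ?expR_ge0 ?(ltW c0).
    have := powR_expR_le x t x0 t0; rewrite -/(g1 t) -/(e t) -/c => h.
    rewrite addrAC -addrA addr_ge0 ?subr_ge0//.
    by rewrite !mulr_ge0 ?powR_ge0 ?expR_ge0// ltW.
  - apply/continuous_within_itvcyP; split.
      move=> t; rewrite in_itv/= andbT => t0; apply: cvgD.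
        by apply: cvgB; [apply: cvgMr; exact: gcont|exact: gcont].
      by apply: cvgMr; exact: econt.
    apply: cvgD.
      rewrite /g0/g1 !powR0 ?gt_eqF// !mul0r mulr0.
      apply: cvgB; last exact: cvg_powR_expR0.
      by rewrite -[X in _ --> X](mulr0 x); apply: cvgMr; exact: cvg_powR_expR0.
    by apply: cvgMr; apply: cvg_at_right_filter; exact: econt.
  - rewrite -[X in _ --> X](addr0 0); apply: cvgD; first exact: cvg_powR_expR.
    by rewrite -[X in _ --> X](mulr0 (- 2 * c)); apply: cvgMr; exact: cvg_expR_half.
  - by move=> t t0; have [] := is_deriveD (is_derive_powR_expR x t t0) (de t).
  - apply: cvgD; last by apply: cvg_at_right_filter; apply: cvgMr; exact: econt.
    by rewrite /g1 powR0 ?gt_eqF// mul0r; exact: cvg_powR_expR0.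
  - move=> t; rewrite in_itv/= andbT => t0; rewrite derive1E.
    by have [_ ->] := is_deriveD (is_derive_powR_expR x t t0) (de t).
have := Hs; rewrite RintegralD// RintegralB// RintegralZl// He.
rewrite /Gamma addrK -/g0 -/g1 -/D -{2}[2 * c]add0r => /addIr /eqP.
by rewrite subr_eq0 => /eqP ->.
Qed.

Lemma is_derive_ln_Gamma x : 1 < x ->
  is_derive x 1 (fun y : R => ln (Gamma y)) (digamma x).
Proof.
move=> x1; rewrite /digamma derive1E; apply: derivableP.
apply: ex_derive; apply: is_derive1_comp; first exact/is_derive1_ln/Gamma_gt0.
by apply: derivableP; exact: derivable_Gamma.
Qed.

(** The functional equation holds in a neighbourhood of [x]; differentiating both of its sides and
    using uniqueness of the derivative gives the relation. *)
Lemma derive_shift_ln (f : R -> R) (x a b : R) :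
  (forall y, 1 < y -> f (y + 1) = f y + ln y) -> 1 < x ->
  is_derive x 1 f a -> is_derive (x + 1) 1 f b -> b = a + x^-1.
Proof.
move=> fS x1 fa fb; have x0 : 0 < x by apply: lt_trans x1.
have h1 : is_derive x (1 : R) (fun y : R => y + 1) (1 : R).
  exact: (@is_derive_shift R x 1 1).
have h2 : is_derive x 1 (f \o (fun y => y + 1)) (b * 1) by exact: is_derive1_comp.
have h3 : is_derive x 1 (f \o (fun y => y + 1)) (a + x^-1).
  apply: (near_eq_is_derive _ (is_deriveD fa (is_derive1_ln x0))).
  by near=> y; rewrite /= fS//; near: y; exact: lt_nbhsr.
by rewrite -[LHS]mulr1; case: h2 => _ <-; case: h3 => _ <-.
Unshelve. all: by end_near. Qed.

Lemma digammaS x : 1 < x -> digamma (x + 1) = digamma x + x^-1.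
Proof.
move=> x1; have x2 : 1 < x + 1 by lra.
apply: (derive_shift_ln _ _ _ _ _ x1 (is_derive_ln_Gamma x x1) (is_derive_ln_Gamma _ x2)).
move=> y y1; rewrite GammaS// mulrC lnM// posrE; first exact: Gamma_gt0.
exact: lt_trans y1.
Qed.

End gamma_integrand.

(** * Range of a sample of uniform variables *)

Section power_bounds.
Context {R : realType}.
Implicit Types x y : R.

(** Each of the [n] terms [x^(n-1-i) y^i] of the factored difference lies between [y^(n-1)] and
    [x^(n-1)]. *)
Lemma subrXX_le n x y : 0 <= y -> y <= x ->
  n%:R * y ^+ n.-1 * (x - y) <= x ^+ n - y ^+ n <= n%:R * x ^+ n.-1 * (x - y).
Proof.
move=> y0 yx; have x0 := le_trans y0 yx.
rewrite subrXX [X in _ <= X <= _]mulrC.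
case: n => [|n]; first by rewrite big_ord0 !mul0r lexx.
have xy0 : 0 <= x - y by rewrite subr_ge0.
apply/andP; split; apply: ler_wpM2r => //=.
- rewrite mulr_natl -[X in _ *+ X](card_ord n.+1) -sumr_const.
  apply: ler_sum => i _; rewrite -[in leLHS](@subnK i n) ?exprD; last by rewrite -ltnS.
  by rewrite ler_pM ?exprn_ge0// lerXn2r.
- rewrite mulr_natl -[X in _ *+ X](card_ord n.+1) -sumr_const.
  apply: ler_sum => i _; rewrite -[in leRHS](@subnK i n) ?exprD; last by rewrite -ltnS.
  by rewrite ler_pM ?exprn_ge0// lerXn2r.
Qed.

(** The difference quotient lies between [A y] and [B y] on each side of [x], but with the order
    reversed: in the application [A] decreases and [B] increases. *)
Lemma is_derive_squeeze (f A B : R -> R) x l :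
  A y @[y --> x] --> l -> B y @[y --> x] --> l ->
  (\forall y \near x, x < y -> A y * (y - x) <= f y - f x <= B y * (y - x)) ->
  (\forall y \near x, y < x -> B y * (x - y) <= f x - f y <= A y * (x - y)) ->
  is_derive x 1 f l.
Proof.
move=> Al Bl gt lt.
suff : (fun h => h^-1 *: (f (h *: 1 + x) - f x)) @ 0^' --> l.
  move=> h; apply: DeriveDef; first by apply/cvg_ex; exists l; exact: h.
  by apply/cvg_lim.
apply/cvgrPdist_le => e e0.
have e20 : 0 < e / 2 by rewrite divr_gt0.
move/cvgrPdist_le : (Al) => /(_ _ e20) Ae.
move/cvgrPdist_le : (Bl) => /(_ _ e20) Be.
have shiftn (Q : set R) : nbhs x Q -> \forall h \near (0 : R)^', Q (h *: 1 + x).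
  move=> [d /= d0 dQ]; exists d => // h /= hd _; apply: dQ => /=.
  by rewrite /GRing.scale/= mulr1 opprD addrCA subrr addr0 -[X in `|X|]add0r.
near=> h.
have h0 : h != 0 by near: h; exact: nbhs_dnbhs_neq.
have : `|l - A (h *: 1 + x)| <= e / 2 by near: h; exact: (shiftn _ Ae).
have : `|l - B (h *: 1 + x)| <= e / 2 by near: h; exact: (shiftn _ Be).
have : x < h *: 1 + x -> A (h *: 1 + x) * (h *: 1 + x - x) <=
   f (h *: 1 + x) - f x <= B (h *: 1 + x) * (h *: 1 + x - x).
  by near: h; exact: (shiftn _ gt).
have : h *: 1 + x < x -> B (h *: 1 + x) * (x - (h *: 1 + x)) <=
   f x - f (h *: 1 + x) <= A (h *: 1 + x) * (x - (h *: 1 + x)).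
  by near: h; exact: (shiftn _ lt).
have -> : h *: 1 = h by rewrite /GRing.scale/= mulr1.
rewrite /GRing.scale/= !ler_distl.
have [hn|hp|/eqP] := ltgtP h 0; last by rewrite (negbTE h0).
- rewrite gtrDr => /(_ hn) /andP[h1 h2] _ /andP[h3 h4] /andP[h5 h6].
  have hV : h^-1 * (f (h + x) - f x) = (f x - f (h + x)) / (x - (h + x)).
    by field; rewrite h0 opprD addrCA subrr addr0 oppr_eq0 h0.
  have hx : 0 < x - (h + x) by lra.
  rewrite hV; apply/andP; split.
    rewrite lerBlDr ler_pdivrMr//; apply: (le_trans h2).
    by apply: ler_wpM2r; [exact: ltW|lra].
  rewrite -lerBlDr ler_pdivlMr//; apply: le_trans h1.
  by apply: ler_wpM2r; [exact: ltW|lra].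
- rewrite ltrDr => _ /(_ hp) /andP[h1 h2] /andP[h3 h4] /andP[h5 h6].
  have hV : h^-1 * (f (h + x) - f x) = (f (h + x) - f x) / (h + x - x).
    by rewrite addrK mulrC.
  have hx : 0 < h + x - x by lra.
  rewrite hV; apply/andP; split.
    rewrite lerBlDr ler_pdivrMr//; apply: (le_trans h2).
    by apply: ler_wpM2r; [exact: ltW|lra].
  rewrite -lerBlDr ler_pdivlMr//; apply: le_trans h1.
  by apply: ler_wpM2r; [exact: ltW|lra].
Unshelve. all: by end_near. Qed.

End power_bounds.

Section probability_reals.
Context {R : realType} {d : measure_display} {T : measurableType d}.
Variable P : probability T R.
Implicit Types A B : set T.

Lemma fine_probability_le A B : measurable A -> measurable B -> A `<=` B ->
  fine (P A) <= fine (P B).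
Proof.
move=> mA mB AB; rewrite fine_le ?fin_num_measure//.
by apply: le_measure => //; rewrite inE.
Qed.

Lemma fine_probabilityD A B : measurable A -> measurable B -> B `<=` A ->
  fine (P (A `\` B)) = fine (P A) - fine (P B).
Proof.
move=> mA mB BA; rewrite measureD//; last by rewrite ltey_eq fin_num_measure.
by rewrite (setIidr BA) fineB ?fin_num_measure.
Qed.

Lemma measurable_ltr (f g : T -> R) :
  measurable_fun setT f -> measurable_fun setT g -> measurable [set w | f w < g w].
Proof.
move=> mf mg; have := measurable_fun_ltr mf mg.
by move=> /(_ measurableT [set true] Logic.I); rewrite setTI.
Qed.

Lemma measurable_ler (f g : T -> R) :
  measurable_fun setT f -> measurable_fun setT g -> measurable [set w | f w <= g w].
Proof.
move=> mf mg; have := measurable_fun_ler mf mg.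
by move=> /(_ measurableT [set true] Logic.I); rewrite setTI.
Qed.

Lemma measurable_forall_lt n (A : nat -> set T) : (forall i, measurable (A i)) ->
  measurable [set w | forall i, (i < n)%N -> A i w].
Proof.
move=> mA; have -> : [set w | forall i, (i < n)%N -> A i w] = \bigcap_(i in `I_n) A i.
  by apply/seteqP; split => w h i; exact: h.
by apply: fin_bigcap_measurable => //; exact: finite_II.
Qed.

End probability_reals.

(* The increments of [Phi] are bracketed by those of [u |-> (u - v^r)^n] and
   [u |-> (u - u^r)^n], whence [Phi' u = n (u - u^r)^(n-1)]. *)
Section uniform_range.
Context {R : realType} {d : measure_display} {T : measurableType d}.
Variables (P : probability T R) (U : nat -> T -> R).
Hypothesis mU : forall i, measurable_fun setT (U i).
Hypothesis U_gt0 : forall i w, 0 < U i w.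

(** Half-open sides make [box n 0 v] minus [box n 0 u] the event that the maximum lies in [[u, v[],
    and make [box n 0 0] empty for [n > 0]. *)
Let box n a b := [set w | forall i, (i < n)%N -> a <= U i w < b].
Hypothesis PU : forall n (a b : R), 0 <= a -> a <= b -> b <= 1 ->
  fine (P (box n a b)) = (b - a) ^+ n.

Variables (n : nat) (r : R).
Hypothesis r1 : 1 < r.

(** The pairwise form of [min U >= (max U)^r], which names neither extremum. *)
Let close := [set w | forall i, (i < n.+1)%N -> forall j, (j < n.+1)%N ->
  U j w `^ r <= U i w].
Let Phi u := fine (P (box n.+1 0 u `&` close)).

Let mbox m a b : measurable (box m a b).
Proof.
apply: (measurable_forall_lt m (fun i => [set w | a <= U i w < b])) => i.
have -> : [set w | a <= U i w < b] = [set w | a <= U i w] `&` [set w | U i w < b].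
  by apply/seteqP; split => w; [move/andP|move=> h; apply/andP].
by apply: measurableI; [exact: measurable_ler|exact: measurable_ltr].
Qed.

Let mclose : measurable close.
Proof.
apply: (measurable_forall_lt _ (fun i => [set w | forall j, (j < n.+1)%N ->
  U j w `^ r <= U i w])) => i.
apply: (measurable_forall_lt _ (fun j => [set w | U j w `^ r <= U i w])) => j.
apply: measurable_ler => //.
by apply: (@measurableT_comp _ _ _ _ _ _ (fun x : R => x `^ r)).
Qed.

Let r0 : 0 < r. Proof. exact: lt_trans r1. Qed.

Let Phi_diff (u v : R) : u <= v -> Phi v - Phi u =
  fine (P ((box n.+1 0 v `&` close) `\` (box n.+1 0 u `&` close))).
Proof.
move=> uv; rewrite fine_probabilityD//; [exact: measurableI..|].
move=> w [h1 h2]; split => // i /h1 /andP[-> /=]; move/lt_le_trans; exact.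
Qed.

Let max_witness u v w : ((box n.+1 0 v `&` close) `\` (box n.+1 0 u `&` close)) w ->
  exists2 j, (j < n.+1)%N & u <= U j w.
Proof.
move=> [[_ h] h2]; apply: contrapT => h3; apply: h2; split => // i ni.
rewrite (ltW (U_gt0 _ _))/= ltNge; apply/negP => h4; apply: h3; by exists i.
Qed.

Let mdiff u v : measurable ((box n.+1 0 v `&` close) `\` (box n.+1 0 u `&` close)).
Proof. by apply: measurableD; exact: measurableI. Qed.

Let box_sub a u v : u <= v -> box n.+1 a u `<=` box n.+1 a v.
Proof. by move=> uv w h i /h /andP[-> /=]; move/lt_le_trans; exact. Qed.

(** A crude bound that drops [close]; it gives continuity of [Phi] at 0 and 1, where the derivative
    is not computed. *)
Let Phi_diff_le (u v : R) : 0 <= u -> u <= v -> v <= 1 -> Phi v - Phi u <= v ^+ n.+1 - u ^+ n.+1.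
Proof.
move=> u0 uv v1; rewrite Phi_diff//.
have := @PU n.+1 0 u (lexx _) u0 (le_trans uv v1).
have := @PU n.+1 0 v (lexx _) (le_trans u0 uv) v1.
rewrite !subr0 => <- <-; rewrite -fine_probabilityD//; last exact: box_sub.
apply: fine_probability_le => //; first exact: measurableD.
move=> w h; case: (h) => -[h1 h2] h3; split => // h4; exact: h3.
Qed.

(** If the maximum is at least [u], closeness forces every [U i] to be at least [u^r]. *)
Let Phi_diff_ub (u v : R) : 0 <= u -> u <= v -> v <= 1 ->
  Phi v - Phi u <= (v - u `^ r) ^+ n.+1 - (u - u `^ r) ^+ n.+1.
Proof.
move=> u0 uv v1; rewrite Phi_diff//.
have ur : u `^ r <= u.
  move: u0; rewrite le_eqVlt => /predU1P[<-|u0]; first by rewrite powR0 ?gt_eqF.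
  by apply: ge1r_powR; rewrite ?u0 ?(le_trans uv)// ltW.
have := @PU n.+1 (u `^ r) u (powR_ge0 _ _) ur (le_trans uv v1).
have := @PU n.+1 (u `^ r) v (powR_ge0 _ _) (le_trans ur uv) v1.
move=> <- <-; rewrite -fine_probabilityD//; last exact: box_sub.
apply: fine_probability_le => //; first exact: measurableD.
move=> w h; have [j nj uj] := max_witness _ _ _ h.
case: h => -[h1 h2] h3; split.
  move=> i ni; have /andP[_ ->] := h1 _ ni; rewrite andbT.
  apply: le_trans (h2 _ ni _ nj).
  by apply: ge0_ler_powR; rewrite ?nnegrE ?(ltW r0)// ltW.
by move=> /(_ _ nj) /andP[_]; rewrite ltNge uj.
Qed.

(** Conversely, values in [[v^r, v[] are automatically close, since [U j ^ r <= v^r <= U i]. *)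
Let Phi_diff_lb (u v : R) : 0 <= u -> u <= v -> v <= 1 -> v `^ r <= u ->
  (v - v `^ r) ^+ n.+1 - (u - v `^ r) ^+ n.+1 <= Phi v - Phi u.
Proof.
move=> u0 uv v1 vru; rewrite Phi_diff//.
have := @PU n.+1 (v `^ r) u (powR_ge0 _ _) vru (le_trans uv v1).
have := @PU n.+1 (v `^ r) v (powR_ge0 _ _) (le_trans vru uv) v1.
move=> <- <-; rewrite -fine_probabilityD//; last exact: box_sub.
apply: fine_probability_le => //; first exact: measurableD.
move=> w [h1 h2]; split; first split.
- by move=> i ni; have /andP[_ ->] := h1 _ ni; rewrite andbT ltW.
- move=> i ni j nj; have /andP[+ _] := h1 _ ni; apply: le_trans.
  have /andP[_ h] := h1 _ nj.
  by apply: ge0_ler_powR; rewrite ?nnegrE ?(ltW r0) ?(ltW (U_gt0 _ _)) ?(le_trans u0)// ltW.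
- move=> [h3 _]; apply: h2 => i ni.
  by have /andP[-> _] := h1 _ ni; have /andP[_ ->] := h3 _ ni.
Qed.

Let cvg_at_powR (u : R) : 0 < u -> v `^ r @[v --> u] --> u `^ r.
Proof.
move=> u0; apply: (@differentiable_continuous _ _ _ _ (fun t => t `^ r)).
by apply/derivable1_diffP; apply: derivable_powR; rewrite in_itv/= andbT.
Qed.

Let is_derive_Phi (u : R) : 0 < u < 1 ->
  is_derive u 1 Phi (n.+1%:R * (u - u `^ r) ^+ n).
Proof.
move=> /andP[u0 u1].
have uru : u `^ r < u.
  rewrite /powR gt_eqF// -[ltRHS]lnK ?posrE// ltr_expR.
  by rewrite gtr_nMl// ln_lt0// u0.
have [vru [ruv v01]] : (\forall v \near u, v `^ r < u) /\
    (\forall v \near u, u `^ r < v) /\ (\forall v \near u, 0 < v < 1).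
  split; [|split].
  - exact: (cvgr_lt _ (cvg_at_powR u u0) _ uru).
  - exact: lt_nbhsr.
  - have h1 := lt_nbhsr u0; have h2 := lt_nbhsl u1.
    by near=> v; apply/andP; split; near: v.
(* Both bounds tend to the value at [u - u^r]. For [v] below [u] the two increment estimates are
   used with [u] and [v] exchanged. *)
apply: (@is_derive_squeeze R Phi (fun v => n.+1%:R * (u - v `^ r) ^+ n)
   (fun v => n.+1%:R * (v - u `^ r) ^+ n)).
- apply: cvgMr; apply: (@continuous_comp _ _ _ (fun v => u - v `^ r) (fun x => x ^+ n)).
    by apply: cvgB; [exact: cvg_cst|exact: cvg_at_powR].
  exact: exprn_continuous.
- apply: cvgMr; apply: (@continuous_comp _ _ _ (fun v => v - u `^ r) (fun x => x ^+ n)).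
    by apply: cvgB; [exact: cvg_id|exact: cvg_cst].
  exact: exprn_continuous.
- near=> v => uv.
  have v1 : v < 1 by near: v; apply: filterS v01 => v /andP[].
  have h1 := Phi_diff_ub u v (ltW u0) (ltW uv) (ltW v1).
  have vr : v `^ r < u by near: v.
  have h2 := Phi_diff_lb u v (ltW u0) (ltW uv) (ltW v1) (ltW vr).
  have ua : 0 <= u - v `^ r by rewrite subr_ge0 ltW.
  have ub : 0 <= u - u `^ r by rewrite subr_ge0 ltW.
  have /andP[h3 _] := subrXX_le n.+1 (v - v `^ r) (u - v `^ r) ua ltac:(by rewrite lerB// ltW).
  have /andP[_ h4] := subrXX_le n.+1 (v - u `^ r) (u - u `^ r) ub ltac:(by rewrite lerB// ltW).
  apply/andP; split.
    by apply: le_trans h2; apply: le_trans h3; rewrite opprB addrA subrK.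
  by apply: (le_trans h1); apply: (le_trans h4); rewrite opprB addrA subrK.
- near=> v => vu.
  have v0 : 0 < v by near: v; apply: filterS v01 => v /andP[].
  have h1 := Phi_diff_ub v u (ltW v0) (ltW vu) (ltW u1).
  have ruv' : u `^ r < v by near: v.
  have h2 := Phi_diff_lb v u (ltW v0) (ltW vu) (ltW u1) (ltW ruv').
  have vrv : v `^ r <= v by apply: ge1r_powR; rewrite ?v0 ?(ltW (lt_trans vu u1))// ltW.
  have ua : 0 <= v - u `^ r by rewrite subr_ge0 ltW.
  have ub : 0 <= v - v `^ r by rewrite subr_ge0.
  have /andP[h3 _] := subrXX_le n.+1 (u - u `^ r) (v - u `^ r) ua ltac:(by rewrite lerB// ltW).
  have /andP[_ h4] := subrXX_le n.+1 (u - v `^ r) (v - v `^ r) ub ltac:(by rewrite lerB// ltW).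
  apply/andP; split.
    by apply: le_trans h2; apply: le_trans h3; rewrite opprB addrA subrK.
  by apply: (le_trans h1); apply: (le_trans h4); rewrite opprB addrA subrK.
Unshelve. all: by end_near. Qed.

Let Phi_ge0 u : 0 <= Phi u. Proof. by rewrite fine_ge0. Qed.

Let Phi0 : Phi 0 = 0.
Proof.
rewrite /Phi (_ : _ `&` _ = set0) ?measure0//.
apply/seteqP; split => // w [/(_ 0%N isT)]; rewrite ltNge => /andP[_ /negP].
by rewrite (ltW (U_gt0 _ _)).
Qed.

Let Phi_le u v : 0 <= u -> u <= v -> v <= 1 -> Phi u <= Phi v.
Proof. by move=> u0 uv v1; rewrite -subr_ge0 Phi_diff// fine_ge0. Qed.

(** Since [(u - u^r)^n = u^n (1 - u^(r-1))^n], [Phi] and [K] have the same derivative inside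
    [[0, 1]]. Both vanish at 0, so the mean value theorem makes them agree at 1. *)
Lemma uniform_range_prob : fine (P (box n.+1 0 1 `&` close)) =
  n.+1%:R * powR_primitive (r - 1) n%:R n 1.
Proof.
have s0 : 0 <= r - 1 by rewrite subr_ge0 ltW.
have c0 : 0 < n%:R + 1 :> R by rewrite natr1.
pose K u := n.+1%:R * powR_primitive (r - 1) n%:R n u.
have dK (u : R) : 0 < u -> is_derive u 1 K (n.+1%:R * (u - u `^ r) ^+ n).
  move=> u0.
  apply: (is_derive_eq (is_deriveZ n.+1%:R (is_derive_powR_primitive _ _ n _ u0 s0 c0))).
  rewrite /GRing.scale/= powR_mulrn ?(ltW u0)// -exprMn mulrBr mulr1; congr (_ * (_ - _) ^+ _).
  by rewrite -{1}(powRr1 (ltW u0)) -powRD ?(gt_eqF u0) ?implybT// addrC subrK.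
have dg (u : R) : u \in `]0, 1[ -> is_derive u 1 (fun u => Phi u - K u) 0.
  rewrite in_itv/= => u01; have /andP[u0 _] := u01.
  by apply: (is_derive_eq (is_deriveB (is_derive_Phi u u01) (dK u u0))); rewrite subrr.
have cX (u : R) : t ^+ n.+1 @[t --> u] --> u ^+ n.+1 by exact: exprn_continuous.
have cg : {within `[0, 1], continuous (fun u => Phi u - K u)}.
  apply/continuous_within_itvP; first exact: ltr01.
  split.
  - move=> u u01; apply: (@differentiable_continuous _ _ _ _ (fun u => Phi u - K u)).
    by apply/derivable1_diffP; have [] := dg u u01.
  - apply: cvgB; last first.
      by apply: cvgMr; rewrite powR_primitive0//; exact: powR_primitive_cvg0.
    rewrite Phi0; apply: (@squeeze_cvgr _ _ _ _ (cst 0) (fun t => t ^+ n.+1)).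
    + near=> t; rewrite Phi_ge0/=.
      have t0 : 0 < t by near: t; exact: nbhs_right_gt.
      have t1 : t <= 1 by near: t; exact: nbhs_right_le.
      by have := Phi_diff_le 0 t (lexx _) (ltW t0) t1; rewrite Phi0 expr0n/= !subr0.
    + exact: cvg_cst.
    + by apply: cvg_at_right_filter; have := cX 0; rewrite expr0n.
  - apply: cvgB; last first.
      apply: cvg_at_left_filter; apply: (@differentiable_continuous _ _ _ _ K).
      by apply/derivable1_diffP; have [] := dK 1 ltr01.
    (* The lower bound restates [Phi 1 - Phi t <= 1 - t^(n+1)]. *)
    apply: (@squeeze_cvgr _ _ _ _ (fun t => t ^+ n.+1 + (Phi 1 - 1)) (cst (Phi 1))).
    + near=> t.
      have t0 : 0 <= t by near: t; exact: nbhs_left_ge.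
      have t1 : t <= 1 by near: t; exact: nbhs_left_le.
      rewrite Phi_le// andbT.
      by have := Phi_diff_le t 1 t0 t1 (lexx _); rewrite expr1n; lra.
    + rewrite -[X in _ --> X](subrKC 1 (Phi 1)); apply: cvgD; last exact: cvg_cst.
      by apply: cvg_at_left_filter; have := cX 1; rewrite expr1n.
    + exact: cvg_cst.
have [c _] := MVT ltr01 dg cg.
rewrite mul0r Phi0 /K powR_primitive0// mulr0 subr0 subr0 => /eqP.
by rewrite subr_eq0 => /eqP.
Unshelve. all: by end_near. Qed.

End uniform_range.

(** * The distribution function *)

(** The reciprocal of the generalised binomial coefficient of [N + a] over [N]; here [N = n - 1]. *)
Definition ratio_prod {R : realType} (N : nat) (a : R) : R :=
  \prod_(k < N) (k.+1%:R / (k.+1%:R + a)).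

Section ratio_prod_theory.
Context {R : realType}.
Implicit Types a s : R.

Lemma fact_prodr (N : nat) : N`!%:R = \prod_(k < N) k.+1%:R :> R.
Proof.
elim: N => [|N IH]; first by rewrite big_ord0.
by rewrite big_ord_recr/= -IH factS natrM mulrC.
Qed.

(** The factor [j = 0] of the denominator cancels the prefactor [N.+1]; dividing each other factor
    [N.+1 + j s] by [s] gives [a + j]. *)
Lemma ratio_prod_powR_primitive N s : 0 < s ->
  N.+1%:R * powR_primitive s N%:R N 1 = ratio_prod N (N.+1%:R / s).
Proof.
move=> s0; rewrite powR_primitive1 ?(ltW s0) ?natr1 ?ltr0n//.
have red (x y z : R) : z != 0 -> z * (x / (z * y)) = x / y.
  by move=> z0; rewrite invfM mulrCA mulVKf.
rewrite big_ord_recl/= mul0r addr0 red ?pnatr_eq0//.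
have -> : s ^+ N = \prod_(k < N) s by rewrite prodr_const card_ord.
rewrite fact_prodr -big_split/= -prodf_div; apply: eq_bigr => k _.
have h1 : 0 < N.+1%:R :> R by rewrite ltr0n.
have h2 : 0 < k.+1%:R :> R by rewrite ltr0n.
rewrite /bump /= add1n; field.
by rewrite !nat1r gt_eqF//= gt_eqF// addr_gt0// mulr_gt0.
Qed.

Lemma ratio_prod_Beta (m : nat) a : 0 < a ->
  ratio_prod m.+1 a = m.+1%:R * Beta (a + 1) m.+1%:R.
Proof.
move=> a0; rewrite Beta_natr// mulrA -natrM -factS fact_prodr -prodf_div.
by apply: eq_bigr => k _; congr (_ / _); rewrite -natr1; ring.
Qed.

End ratio_prod_theory.

(** * Reduction of the exponential sample to a uniform one *)

Section exponential_law.
Context {R : realType}.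

Lemma exponential_prob_expR_lt (lam u : R) : 0 < lam -> 0 <= u <= 1 ->
  exponential_prob lam [set x | expR (- lam * x) < u] = u%:E.
Proof.
(* The case [u = 0] is apart: the default value of [ln 0] would give a wrong threshold [y]. *)
move=> lam0 /andP[]; rewrite le_eqVlt => /predU1P[<- _|u0 u1].
  rewrite (_ : [set x | _] = set0) /exponential_prob ?integral_set0//.
  by apply/seteqP; split => // x /=; rewrite ltNge expR_ge0.
pose y := - ln u / lam.
have y0 : 0 <= y by rewrite divr_ge0 ?(ltW lam0)// oppr_ge0 ln_le0.
have -> : [set x | expR (- lam * x) < u] = `]y, +oo[%classic.
  apply/seteqP; split => x /=; rewrite in_itv/= andbT -{1}[u]lnK ?posrE// ltr_expR /y;
    by rewrite ltr_pdivrMr// mulNr ltrNl mulrC.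
rewrite /exponential_prob.
have sub : `[y, +oo[ `<=` `[0, +oo[%classic.
  by move=> x /=; rewrite !in_itv/= !andbT; exact: le_trans.
have cE : continuous (fun x : R => expR (- lam * x)).
  move=> x; apply: (@continuous_comp _ _ _ (fun x => - lam * x) expR).
    by apply: cvgMr; exact: cvg_id.
  exact: continuous_expR.
rewrite integral_itv_obnd_cbnd; last first.
  by apply/measurable_EFinP; apply: measurable_funTS; exact: measurable_exponential_pdf.
rewrite (@ge0_continuous_FTC2y _ _ (fun x => - (expR (- lam * x))) _ 0)//.
- rewrite /y EFinN oppeK add0e; congr EFin.
  rewrite mulrCA !mulNr divff ?gt_eqF// mulrN1 opprK lnK//.
- by move=> x _; apply: exponential_pdf_ge0; exact: ltW.
- by apply: (continuous_subspaceW sub); exact: within_continuous_exponential_pdf.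
- rewrite -oppr0; apply: cvgN.
  rewrite (_ : (fun x => expR (- lam * x)) =
               (fun z => expR (- z)) \o (fun z => lam * z)); last first.
    by apply: eq_fun => x; rewrite mulNr.
  apply: (@cvg_comp _ _ _ _ _ _ (pinfty_nbhs R)); last exact: cvgr_expR.
  exact: gt0_cvgMry.
- by apply: cvgN; apply/cvg_at_right_filter; exact: cE.
- move=> x; rewrite in_itv/= andbT => yx.
  by apply: derive1_exponential_pdf; rewrite in_itv/= andbT (le_lt_trans y0).
Qed.

End exponential_law.

Section range_of_exponentials.
Context {R : realType} {d : measure_display} {T : measurableType d}.
Variables (P : probability T R) (X : nat -> {RV P >-> R}) (lam rho : R).
Hypotheses (lam0 : 0 < lam) (rho1 : 1 < rho) (iidX : iid_exp X lam).

Let U i w := expR (- lam * X i w).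

Let mU i : measurable_fun setT (U i).
Proof.
apply: measurableT_comp => //; apply: measurable_funM => //.
Qed.

Let ln_rho0 : 0 < ln rho. Proof. by rewrite ln_gt0. Qed.

Lemma iid_exp_box n (a b : R) : 0 <= a -> a <= b -> b <= 1 ->
  fine (P [set w | forall i, (i < n)%N -> a <= U i w < b]) = (b - a) ^+ n.
Proof.
move=> a0 ab b1; have [indep law] := iidX.
pose B := [set x | a <= expR (- lam * x) < b].
pose V (u : R) := [set x | expR (- lam * x) < u].
have mexp : measurable_fun setT (fun x : R => expR (- lam * x)).
  by apply: measurableT_comp => //; apply: measurable_funM.
have mV u : measurable (V u) by apply: measurable_ltr.
have BE : B = V b `\` V a.
  apply/seteqP; split => x.
    by move=> /andP[h1 h2]; split => //; apply/negP; rewrite -leNgt.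
  by move=> [h1 h2]; apply/andP; split => //; rewrite leNgt; apply/negP.
have mB : measurable B by rewrite BE; exact: measurableD.
have PV i u : 0 <= u <= 1 -> P (X i @^-1` V u) = u%:E.
  by move=> u01; rewrite -(exponential_prob_expR_lt lam u lam0 u01); exact: law.
have PB i : fine (P (X i @^-1` B)) = b - a.
  rewrite BE -[X i @^-1` _]/((X i @^-1` V b) `\` (X i @^-1` V a)) fine_probabilityD//.
  - by rewrite !PV ?a0 ?b1 ?(le_trans a0) ?(le_trans ab)//.
  - by rewrite -[X in measurable X]setTI; exact: measurable_funPT.
  - by rewrite -[X in measurable X]setTI; exact: measurable_funPT.
  - by move=> w /=; rewrite /V/= => /lt_le_trans; exact.
have /= := indep (iota 0 n) (fun=> B) (iota_uniq 0 n) (fun=> mB).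
rewrite [X in _ = X](eq_bigr (fun=> b - a)); last by move=> i _; exact: PB.
rewrite big_const_seq count_predT size_iota iter_mulr_1 => <-; congr (fine (P _)).
rewrite -bigcap_seq; apply/seteqP; split => w h i /=.
  by rewrite mem_iota => /h.
by move=> ni; apply: h; rewrite /= mem_iota.
Qed.

Let measurable_bigmax n (g : T -> R) (f : nat -> T -> R) : measurable_fun setT g ->
  (forall i, measurable_fun setT (f i)) ->
  measurable_fun setT (fun w => \big[Order.max/g w]_(i < n) f i w).
Proof.
move=> mg; elim: n f => [|n IH] f mf.
  by under eq_fun do rewrite big_ord0.
under eq_fun do rewrite big_ord_recl.
by apply: measurable_maxr => //; apply: (IH (fun i => f i.+1)).
Qed.

Let measurable_bigmin n (g : T -> R) (f : nat -> T -> R) : measurable_fun setT g ->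
  (forall i, measurable_fun setT (f i)) ->
  measurable_fun setT (fun w => \big[Order.min/g w]_(i < n) f i w).
Proof.
move=> mg; elim: n f => [|n IH] f mf.
  by under eq_fun do rewrite big_ord0.
under eq_fun do rewrite big_ord_recl.
by apply: measurable_minr => //; apply: (IH (fun i => f i.+1)).
Qed.

Lemma measurable_Mn n : measurable_fun setT (Mn X rho n).
Proof.
apply: measurable_funD => //; apply: measurable_funM => //.
apply: measurable_funB; apply: measurableT_comp => //.
  by apply: (measurable_bigmax n (X 0%N) (fun i => X i)).
by apply: (measurable_bigmin n (X 0%N) (fun i => X i)).
Qed.

Lemma measurable_Mn_le n (m : R) : measurable [set w | Mn X rho n w <= m].
Proof. by apply: measurable_ler => //; exact: measurable_Mn. Qed.

Lemma cdfM_le n (x y : R) : x <= y -> cdfM X rho n x <= cdfM X rho n y.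
Proof.
move=> xy; apply: fine_probability_le; [exact: measurable_Mn_le..|].
by move=> w /= /le_trans; exact.
Qed.

(** Positivity keeps [ln] away from its default values, so the event is [max <= r * min]. The
    starting value [X 0] of both big operators belongs to the sample, which is nonempty. *)
Let Mn_leE n (m : R) w : (forall i, (i < n.+1)%N -> 0 < X i w) ->
  Mn X rho n.+1 w <= m <-> forall i, (i < n.+1)%N -> forall j, (j < n.+1)%N ->
    X i w <= rho `^ (m - 1) * X j w.
Proof.
move=> X0; set r := rho `^ (m - 1).
have r0 : 0 < r by rewrite powR_gt0// (lt_trans ltr01).
have min0 : 0 < Defs.ord_min X n.+1 w.
  by apply/lt_bigmin; [exact: X0|move=> i _; exact: X0].
have leM (i : 'I_n.+1) : X i w <= Defs.ord_max X n.+1 w by exact: le_bigmax.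
have leN (i : 'I_n.+1) : Defs.ord_min X n.+1 w <= X i w by exact: bigmin_le.
have max0 : 0 < Defs.ord_max X n.+1 w by apply: lt_le_trans (leM ord0); exact: X0.
have -> : (Mn X rho n.+1 w <= m) = (Defs.ord_max X n.+1 w <= r * Defs.ord_min X n.+1 w).
  rewrite -[RHS]ler_ln ?posrE ?mulr_gt0// lnM ?posrE// ln_powR.
  by rewrite /Mn -lerBrDr ler_pdivrMr// lerBlDr.
split=> [h i ni j nj|h].
  apply: (le_trans (leM (Ordinal ni))); apply: (le_trans h).
  by rewrite ler_pM2l//; exact: (leN (Ordinal nj)).
have {}h i : (i < n.+1)%N -> X i w <= r * Defs.ord_min X n.+1 w.
  move=> ni; rewrite mulrC -ler_pdivrMr//; apply: le_bigmin.
    by rewrite ler_pdivrMr// mulrC; exact: h.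
  by move=> j _; rewrite ler_pdivrMr// mulrC; exact: h.
by apply: bigmax_le => [|i _]; exact: h.
Qed.

(** In terms of [U], [X i <= r * X j] reads [U j ^ r <= U i]. The two events agree on [box], where
    every [X i] is positive, and [box] has probability 1. *)
Lemma cdfM_prod n (m : R) : 1 < m ->
  cdfM X rho n.+1 m = ratio_prod n (n.+1%:R / (rho `^ (m - 1) - 1)).
Proof.
move=> m1; set r := rho `^ (m - 1).
have r1 : 1 < r by exact: powR_sub1_gt1.
have s0 : 0 < r - 1 by rewrite subr_gt0.
rewrite -(ratio_prod_powR_primitive n (r - 1) s0).
have U0 i w : 0 < U i w by exact: expR_gt0.
rewrite -(@uniform_range_prob _ _ _ P U mU U0 iid_exp_box n r r1).
set box := [set w | _]; set close := [set w | _].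
have boxE w : box w <-> forall i, (i < n.+1)%N -> 0 < X i w.
  have h0 i : (0 <= U i w < 1) = (0 < X i w).
    by rewrite ltW//= -expR0 ltr_expR mulNr oppr_lt0 pmulr_rgt0.
  by split => h i /h; rewrite h0.
have closeE w : close w <-> forall i, (i < n.+1)%N -> forall j, (j < n.+1)%N ->
    X i w <= r * X j w.
  have h0 i j : (U j w `^ r <= U i w) = (X i w <= r * X j w).
    rewrite /powR gt_eqF// /U expRK ler_expR mulrCA !mulNr lerN2 ler_pM2l//.
  by split => h i ni j nj; have := h i ni j nj; rewrite h0.
have mbox : measurable box.
  apply: (measurable_forall_lt _ (fun i => [set w | 0 <= U i w < 1])) => i.
  have -> : [set w | 0 <= U i w < 1] = [set w | U i w < 1].
    by apply/seteqP; split => w /=; rewrite (ltW (U0 _ _)).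
  by apply: measurable_ltr.
have Pbox : fine (P box) = 1.
  by have := iid_exp_box n.+1 0 1 (lexx _) ler01 (lexx _); rewrite subr0 expr1n.
pose A := [set w | Mn X rho n.+1 w <= m].
have mA : measurable A by exact: measurable_Mn_le.
have <- : A `&` box = box `&` close.
  rewrite setIC; apply/seteqP; split => w [h1 h2]; split => //.
    by apply/closeE/Mn_leE => //; exact/boxE.
  by apply/Mn_leE; [exact/boxE|exact/closeE].
apply/eqP; rewrite -subr_eq0 eq_le; apply/andP; split; rewrite /cdfM -/A.
  rewrite -fine_probabilityD//; last exact: measurableI.
  apply: (@le_trans _ _ (fine (P (setT `\` box)))).
    apply: fine_probability_le; [|exact: measurableD|].
      by apply: measurableD => //; exact: measurableI.
    by move=> w [h1 h2]; split => // h3; exact: h2.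
  by rewrite fine_probabilityD// probability_setT Pbox subrr.
by rewrite subr_ge0; apply: fine_probability_le => //; exact: measurableI.
Qed.

End range_of_exponentials.

(** * The density *)

Section density.
Context {R : realType}.
Implicit Types a m : R.

(** The range [-1 < a] includes 0, an end of the interval on which the intermediate value theorem is
    applied in [ratio_prod_surj]. *)
Lemma is_derive_ratio_prod N a : -1 < a ->
  is_derive a 1 (ratio_prod N) (- (ratio_prod N a * \sum_(k < N) (k.+1%:R + a)^-1)).
Proof.
move=> a0; elim: N => [|N IH].
  rewrite big_ord0 mulr0 oppr0.
  have -> : ratio_prod 0 = cst (1 : R) by apply/funext => b; rewrite /ratio_prod big_ord0.
  exact: is_derive_cst.
have k0 : N.+1%:R + a != 0.
  by rewrite gt_eqF// -natr1 -addrA ltr_wpDl// -ltrBlDl sub0r.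
have h1 : is_derive a 1 (fun b : R => N.+1%:R + b) 1.
  have -> : (fun b : R => N.+1%:R + b) = (fun b => b + N.+1%:R).
    by apply/funext => b; rewrite addrC.
  exact: (@is_derive_shift R a 1 N.+1%:R).
have h2 : is_derive a 1 (fun b : R => N.+1%:R / (N.+1%:R + b))
    (- (N.+1%:R / (N.+1%:R + a) ^+ 2)).
  apply: (is_derive_eq (is_deriveZ N.+1%:R (is_deriveV k0 h1))).
  by rewrite /GRing.scale/= mulr1 mulrN.
have h3 := is_deriveM IH h2.
have -> : ratio_prod N.+1 = (ratio_prod N : R -> R) * (fun b : R => N.+1%:R / (N.+1%:R + b)).
  by apply/funext => b; rewrite /ratio_prod big_ord_recr.
apply: (is_derive_eq h3).
rewrite big_ord_recr/= -[((_ * _) : R -> R) a]/(ratio_prod N a * (N.+1%:R / (N.+1%:R + a))).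
move: (N.+1%:R : R) k0 => c k0; rewrite /GRing.scale/=.
by move: (ratio_prod N a) (\sum_(i < N) _) => p S; field.
Qed.

(** Telescoping of [digammaS]; starting from [a + 1] keeps every argument above 1. *)
Lemma digammaD_nat a N : 0 < a ->
  digamma (a + N.+1%:R) - digamma (a + 1) = \sum_(k < N) (k.+1%:R + a)^-1.
Proof.
move=> a0; elim: N => [|N IH]; first by rewrite big_ord0 subrr.
have aN : 1 < a + N.+1%:R.
  by apply: (@le_lt_trans _ _ N.+1%:R); rewrite ?ler1n ?ltrDr.
rewrite big_ord_recr/= -IH -[N.+2%:R]natr1 addrA (digammaS _ aN).
by rewrite [N.+1%:R + a]addrC addrAC.
Qed.

Lemma is_derive_inv_powR_sub1 (rho c m : R) : 1 < rho -> 1 < m ->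
  is_derive m 1 (fun x : R => c / (rho `^ (x - 1) - 1))
    (- (c * rho `^ (m - 1) * ln rho / (rho `^ (m - 1) - 1) ^+ 2)).
Proof.
move=> rho1 m1; have rho0 : 0 < rho by apply: lt_trans rho1.
have r1 : rho `^ (m - 1) - 1 != 0.
  by rewrite gt_eqF// subr_gt0 powR_sub1_gt1.
have h0 : is_derive m 1 (fun x : R => x - 1) 1 by exact: (@is_derive_shift R m 1 (- 1)).
have h1 := @is_derive1_comp _ _ (fun x => x - 1) _ _ _ (is_derive_powRr rho (m - 1) rho0) h0.
have h2 : is_derive m 1 (fun x : R => rho `^ (x - 1) - 1) (ln rho * rho `^ (m - 1)).
  by apply: (is_derive_eq (is_deriveB h1 (is_derive_cst _ _ _))); rewrite subr0 mulr1.
apply: (is_derive_eq (is_deriveZ c (@is_deriveV _ (fun x => rho `^ (x - 1) - 1) m _ 1 r1 h2))).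
by rewrite /GRing.scale/=; field.
Qed.

End density.

Section density_of_Mn.
Context {R : realType} {d : measure_display} {T : measurableType d}.
Variables (P : probability T R) (X : nat -> {RV P >-> R}) (lam rho : R).
Hypotheses (lam0 : 0 < lam) (rho1 : 1 < rho) (iidX : iid_exp X lam).

Lemma cdfM_Beta n (m : R) : (2 <= n)%N -> 1 < m ->
  cdfM X rho n m =
  (n%:R - 1) * Beta ((rho `^ (m - 1) + n%:R - 1) / (rho `^ (m - 1) - 1)) (n%:R - 1).
Proof.
case: n => [|[|n]]// _ m1; have r1 := powR_sub1_gt1 rho m rho1 m1.
rewrite (cdfM_prod _ _ lam)// ratio_prod_Beta; last by rewrite divr_gt0// subr_gt0.
have -> : (rho `^ (m - 1) + n.+2%:R - 1) / (rho `^ (m - 1) - 1) =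
    n.+2%:R / (rho `^ (m - 1) - 1) + 1.
  by field; rewrite gt_eqF// subr_gt0.
by have -> : n.+2%:R - 1 = n.+1%:R :> R by rewrite -natr1 addrK.
Qed.

Lemma is_derive_cdfM n (m : R) : (2 <= n)%N -> 1 < m ->
  is_derive m 1 (cdfM X rho n)
    (n%:R * rho `^ (m - 1) * cdfM X rho n m * ln rho / (rho `^ (m - 1) - 1) ^+ 2
     * (digamma (n%:R * rho `^ (m - 1) / (rho `^ (m - 1) - 1))
        - digamma ((rho `^ (m - 1) + n%:R - 1) / (rho `^ (m - 1) - 1)))).
Proof.
case: n => [|[|n]]// _ m1; have r1 := powR_sub1_gt1 rho m rho1 m1.
set N := n.+1; set r := rho `^ (m - 1).
have r10 : r - 1 != 0 by rewrite gt_eqF// subr_gt0.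
pose a (x : R) := N.+1%:R / (rho `^ (x - 1) - 1).
have a0 : 0 < a m by rewrite divr_gt0// subr_gt0.
have a1 : -1 < a m by rewrite (lt_trans _ a0)// oppr_lt0.
have h := @is_derive1_comp _ _ a _ _ _ (is_derive_ratio_prod N (a m) a1)
  (is_derive_inv_powR_sub1 rho N.+1%:R m rho1 m1).
have {}h : is_derive m 1 (cdfM X rho N.+1)
  (- (ratio_prod N (a m) * \sum_(k < N) (k.+1%:R + a m)^-1) *
   - (N.+1%:R * r * ln rho / (r - 1) ^+ 2)).
  apply: (near_eq_is_derive _ h); near=> x.
  rewrite (cdfM_prod _ _ lam)//; near: x; exact: lt_nbhsr.
apply: (is_derive_eq h).
have -> : N.+1%:R * r / (r - 1) = a m + N.+1%:R by rewrite /a -/r; field.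
have -> : (r + N.+1%:R - 1) / (r - 1) = a m + 1 by rewrite /a -/r; field.
by rewrite digammaD_nat// (cdfM_prod _ _ lam)// -/r -/(a m); field.
Unshelve. all: by end_near. Qed.

End density_of_Mn.

(** * The quantile function *)

Section ratio_prod_inverse.
Context {R : realType}.
Implicit Types a b q : R.

Lemma ratio_prodE N a : 0 <= a ->
  (ratio_prod N a)^-1 = \prod_(k < N) (1 + a / k.+1%:R).
Proof.
move=> a0; rewrite /ratio_prod -prodfV; apply: eq_bigr => k _.
have k0 : 0 < k.+1%:R :> R by rewrite ltr0n.
have ka0 : 0 < k.+1%:R + a by rewrite ltr_wpDr.
by rewrite invf_div mulrDl divff// gt_eqF.
Qed.

Lemma ratio_prod_gt0 N a : 0 <= a -> 0 < ratio_prod N a.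
Proof.
by move=> a0; apply: prodr_gt0 => k _; rewrite divr_gt0 ?ltr_wpDr.
Qed.

Lemma ratio_prod_lt N a b : 0 <= a -> a < b -> ratio_prod N.+1 b < ratio_prod N.+1 a.
Proof.
move=> a0 ab; have b0 := le_trans a0 (ltW ab).
apply: ltr_prod.
  by apply/hasP; exists ord0 => //; rewrite mem_index_enum.
move=> k _; rewrite divr_ge0 ?ler0n ?addr_ge0//=.
have pos c : 0 <= c -> 0 < k.+1%:R + c by move=> c0; rewrite ltr_wpDr.
by rewrite ltr_pM2l ?ltr0n// ltf_pV2 ?posrE ?pos// ltrD2l.
Qed.

(** Only the first factor [1 + a] is kept, the others being at least 1. This is the source of
    [a <= e^L - 1]. *)
Lemma ratio_prod_ub N a : 0 <= a -> 1 + a <= (ratio_prod N.+1 a)^-1.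
Proof.
move=> a0; rewrite ratio_prodE// big_ord_recl/= divr1 ler_peMr ?addr_ge0//.
elim/big_ind: _ => // [x y|k _]; first exact: mulr_ege1.
by rewrite lerDl divr_ge0.
Qed.

(** Each new term is at most [ln ((N + 2) / (N + 1))], by [ln x <= x - 1] at
    [x = (N + 1) / (N + 2)]. *)
Lemma harmonic_le_ln N : \sum_(k < N.+1) k.+1%:R^-1 <= 1 + ln N.+1%:R :> R.
Proof.
elim: N => [|N IH]; first by rewrite big_ord1 invr1 ln1 addr0.
rewrite big_ord_recr/=; apply: (le_trans (lerD IH (lexx _))).
rewrite -addrA lerD2l -lerBrDl -ln_div ?posrE ?ltr0n//.
have n0 : 0 < N.+2%:R :> R by rewrite ltr0n.
have m0 : 0 < N.+1%:R :> R by rewrite ltr0n.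
rewrite -[leRHS]opprK -[leLHS]opprK lerN2 -lnV ?posrE ?divr_gt0// invf_div.
apply: (le_trans (ln_le_sub1 _ (divr_gt0 m0 n0))).
move: n0; rewrite -[N.+2%:R]natr1 => n0; rewrite le_eqVlt; apply/predU1P; left.
by move: (N.+1%:R : R) n0 => c n0; field; rewrite gt_eqF.
Qed.

(** Termwise [ln (1 + x) <= x], then the harmonic bound; this is the source of
    [L / (1 + ln n) <= a]. *)
Lemma ratio_prod_lb N a : 0 <= a ->
  - ln (ratio_prod N.+1 a) <= a * (1 + ln N.+1%:R).
Proof.
move=> a0; rewrite -lnV ?posrE ?ratio_prod_gt0// ratio_prodE//.
apply: le_trans (ler_wpM2l a0 (harmonic_le_ln N)); rewrite mulr_sumr.
elim: N.+1 => [|m IH]; first by rewrite !big_ord0 ln1.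
rewrite !big_ord_recr/= lnM ?posrE; last 2 first.
- by apply: prodr_gt0 => k _; rewrite ltr_pwDl// divr_ge0.
- by rewrite ltr_pwDl// divr_ge0.
apply: lerD => //; have am : 0 < 1 + a / m.+1%:R by rewrite ltr_pwDl// divr_ge0.
by rewrite -ler_expR lnK ?posrE//; exact: expR_ge1Dx.
Qed.

(** The product is 1 at 0 and at most [q] at [1 / q - 1], by [ratio_prod_ub]. *)
Lemma ratio_prod_surj N q : 0 < q < 1 -> exists2 a, 0 < a & ratio_prod N.+1 a = q.
Proof.
move=> /andP[q0 q1]; have qV : 0 <= q^-1 - 1 by rewrite subr_ge0 invf_ge1// ltW.
have r0 : ratio_prod N.+1 0 = 1 :> R.
  by rewrite /ratio_prod big1// => k _; rewrite addr0 divff// pnatr_eq0.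
have rb : ratio_prod N.+1 (q^-1 - 1) <= q.
  have := ratio_prod_ub N _ qV; rewrite subrKC lef_pV2 ?posrE//.
  exact: ratio_prod_gt0.
have [||a] := @IVT R (ratio_prod N.+1) 0 (q^-1 - 1) q qV.
- apply: derivable_within_continuous => a; rewrite in_itv/= => /andP[a0 _].
  by apply: ex_derive; apply: is_derive_ratio_prod; rewrite (lt_le_trans _ a0)// oppr_lt0.
- by rewrite r0 ge_min rb orbT/= le_max (ltW q1).
rewrite in_itv/= => /andP[a0 _] aq; exists a => //.
by rewrite lt_def a0 andbT; apply/eqP => a00; move: q1; rewrite -aq a00 r0 ltxx.
Qed.

End ratio_prod_inverse.

Section quantile_of_Mn.
Context {R : realType} {d : measure_display} {T : measurableType d}.
Variables (P : probability T R) (X : nat -> {RV P >-> R}) (lam rho : R).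
Hypotheses (lam0 : 0 < lam) (rho1 : 1 < rho) (iidX : iid_exp X lam).

Lemma quantME n a (q : R) : 0 < a -> ratio_prod n.+1 a = q ->
  quantM X rho n.+2 q = 1 + ln (1 + n.+2%:R / a) / ln rho.
Proof.
move=> a0 aq; set mq := (X in _ = X).
have ln_rho0 : 0 < ln rho by rewrite ln_gt0.
have na0 : 0 < n.+2%:R / a by rewrite divr_gt0.
have mq1 : 1 < mq by rewrite /mq ltrDl divr_gt0// ln_gt0// ltrDl.
have powmq : rho `^ (mq - 1) = 1 + n.+2%:R / a.
  rewrite /mq addrAC subrr add0r /powR gt_eqF ?(lt_trans ltr01)//.
  by rewrite divfK ?gt_eqF// lnK// posrE addr_gt0.
have qle : q <= cdfM X rho n.+2 mq.
  rewrite (cdfM_prod _ _ lam)// powmq addrAC subrr add0r.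
  by rewrite invf_div mulrCA divff ?mulr1 ?aq// pnatr_eq0.
have lbq : lbound [set x | q <= cdfM X rho n.+2 x] mq.
  move=> x /= qx; rewrite leNgt; apply/negP => xmq.
  (* The product formula holds only above 1, while [x] is arbitrary; a point [y] between [max x 1]
     and [mq] is used in its place, by monotonicity of the distribution function. *)
  have xmq1 : Num.max x 1 < mq by rewrite gt_max xmq mq1.
  have := midf_lt xmq1; set y := (_ / _) => -[y1 y2].
  move: y1; rewrite gt_max => /andP[xy y1].
  have := le_trans qx (cdfM_le P X rho _ _ _ (ltW xy)).
  rewrite (cdfM_prod _ _ lam)// -aq leNgt => /negP; apply.
  apply: ratio_prod_lt; first exact: ltW.
  have yr := powR_sub1_gt1 rho y rho1 y1.
  rewrite ltr_pdivlMr ?subr_gt0// mulrC -ltr_pdivlMr// ltrBlDl -powmq.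
  rewrite /powR !gt_eqF ?(lt_trans ltr01)// ltr_expR.
  by rewrite ltr_pM2r// ltrD2r.
apply/eqP; rewrite eq_le; apply/andP; split.
  by apply: ge_inf => //; exists mq.
by apply: lb_le_inf => //; exists mq.
Qed.

End quantile_of_Mn.

(** * Asymptotics of the quantile function *)

Section asymptotics.
Context {R : realType}.

(* [ln y <= e y - 1 - ln e] for every [e > 0], so the logarithmic error term is
   negligible before [D]. *)
Lemma cvg_log_perturbation {U : Type} (F : set_system U) {FF : Filter F}
    (D f : U -> R) (K : R) : 1 <= K -> D @ F --> +oo ->
  (\forall u \near F, D u - K <= f u <= D u + K + ln (D u + 2 * K)) ->
  (fun u => f u / D u) @ F --> (1 : R).
Proof.
move=> K1 Doo fD; apply/cvgrPdist_le => e e0.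
have e20 : 0 < e / 2 by rewrite divr_gt0.
(* The second entry makes [K <= e * D]. The third absorbs the constants left in the upper bound by
   [ln y <= y - 1] at [y = e / 2 * (D + 2 * K)]. *)
pose M := Num.max 1 (Num.max (K / e) ((K + e * K - ln (e / 2)) / (e / 2))).
near=> u.
have : M <= D u by near: u; exact: cvgry_ge.
rewrite !ge_max => /andP[D1 /andP[]].
rewrite !ler_pdivrMr// => DK DK2.
have D0 : 0 < D u by apply: lt_le_trans D1.
have /andP[f1 f2] : D u - K <= f u <= D u + K + ln (D u + 2 * K) by near: u.
have h := ln_le_sub1 (e / 2 * (D u + 2 * K)).
have DK0 : 0 < D u + 2 * K by rewrite addr_gt0// mulr_gt0// (lt_le_trans ltr01).
have {}h := h (mulr_gt0 e20 DK0).
rewrite lnM ?posrE// in h.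
rewrite distrC ler_distl; apply/andP; split.
  by rewrite ler_pdivlMr// mulrBl mul1r [e * _]mulrC; lra.
rewrite ler_pdivrMr//; move: h DK2 f2; lra.
Unshelve. all: by end_near. Qed.

Lemma near_left1_ln (e : R) : 0 < e ->
  \forall q \near (1 : R)^'-, 0 < q < 1 /\ - ln q <= e.
Proof.
move=> e0; near=> q.
have q0 : 0 < q by near: q; exact: nbhs_left_gt.
have q1 : q < 1 by near: q; exact: nbhs_left_lt.
split; first by rewrite q0.
rewrite lerNl -ler_expR lnK ?posrE//; near: q; apply: nbhs_left_ge.
by rewrite -[ltRHS]expR0 ltr_expR oppr_lt0.
Unshelve. all: by end_near. Qed.

Lemma near_right0_ln (M : R) :
  \forall q \near (0 : R)^'+, 0 < q < 1 /\ M <= - ln q.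
Proof.
near=> q.
have q0 : 0 < q by near: q; exact: nbhs_right_gt.
have q1 : q < 1 by near: q; exact: nbhs_right_lt.
split; first by rewrite q0.
rewrite lerNr -ler_expR lnK ?posrE//; near: q; apply: nbhs_right_le.
exact: expR_gt0.
Unshelve. all: by end_near. Qed.

Lemma cvg_right0_ln (f : R -> R) (c : R) :
  (forall q, 0 < q < 1 -> 1 <= f q <= 1 + c / - ln q) -> f q @[q --> 0^'+] --> (1 : R).
Proof.
move=> fc; apply/cvgrPdist_le => e e0; near=> q.
have [q01 Lq] : 0 < q < 1 /\ c / e <= - ln q by near: q; exact: near_right0_ln.
have /andP[h1 h2] := fc q q01.
rewrite distrC ger0_norm ?subr_ge0// lerBlDl (le_trans h2)// lerD2l.
have L0 : 0 < - ln q by rewrite oppr_gt0 ln_lt0.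
by rewrite ler_pdivrMr// mulrC -ler_pdivrMr.
Unshelve. all: by end_near. Qed.

Lemma near_infty_ln (A : R) : \forall n \near \oo, A <= ln (n%:R : R).
Proof.
near=> n.
have n0 : (0 < n)%N by near: n; exact: nbhs_infty_gt.
by rewrite -ler_expR lnK ?posrE ?ltr0n//; near: n; exact: nbhs_infty_ger.
Unshelve. all: by end_near. Qed.

End asymptotics.

Section quantile_asymptotics.
Context {R : realType} {d : measure_display} {T : measurableType d}.
Variables (P : probability T R) (X : nat -> {RV P >-> R}) (lam rho : R).
Hypotheses (lam0 : 0 < lam) (rho1 : 1 < rho) (iidX : iid_exp X lam).

Let ln_rho0 : 0 < ln rho. Proof. by rewrite ln_gt0. Qed.

(** This is [ln (n / L)], that is, [approxB] times [ln rho]. *)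
Let gap n (q : R) := ln n%:R - ln (- ln q).

Lemma quantM_bounds n (q L0 : R) : (2 <= n)%N -> 0 < q < 1 -> - ln q <= L0 -> 1 <= L0 ->
  gap n q - L0 <= quantM X rho n q * ln rho <=
  gap n q + ln rho + ln (L0 + 1 + ln n%:R).
Proof.
case: n => [|[|n]]// _ q01 qL L01; have /andP[q0 q1] := q01.
have L_gt0 : 0 < - ln q by rewrite oppr_gt0 ln_lt0.
have [a a0 aq] := ratio_prod_surj n q q01.
rewrite (quantME _ _ lam _ lam0 rho1 iidX _ _ _ a0 aq) mulrDl mul1r divfK ?gt_eqF// /gap.
have n0 : 0 < n.+2%:R :> R by rewrite ltr0n.
have na0 : 0 < n.+2%:R / a by rewrite divr_gt0.
have lnn : ln n.+1%:R <= ln n.+2%:R :> R by rewrite ler_ln ?posrE ?ltr0n// ler_nat.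
have lnn0 : 0 <= ln n.+2%:R :> R by rewrite ln_ge0// ler1n.
apply/andP; split.
  have h : ln (n.+2%:R / a) <= ln (1 + n.+2%:R / a).
    by rewrite ler_ln ?posrE ?addr_gt0// lerDr.
  rewrite ln_div ?posrE// in h.
  suff : ln a <= ln (- ln q) + L0 by move: ln_rho0; lra.
  (* Here [a <= 1 / q - 1 <= L / q], and [ln (L / q) = ln L + L]. *)
  apply: (@le_trans _ _ (ln (- ln q) - ln q)); last by rewrite lerD2l.
  have -> : ln (- ln q) - ln q = ln (- ln q * q^-1).
    by rewrite lnM ?posrE ?invr_gt0// [ln q^-1]lnV.
  rewrite ler_ln ?posrE ?mulr_gt0 ?invr_gt0//.
  have := ratio_prod_ub n a (ltW a0); rewrite aq -lerBrDl => /le_trans; apply.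
  rewrite -(ler_pM2r q0) mulfVK ?gt_eqF// mulrBl mulVf ?gt_eqF// mul1r.
  by have := ln_le_sub1 q q0; lra.
have K0 : 0 < L0 + 1 + ln n.+2%:R by lra.
suff : ln (1 + n.+2%:R / a) <= ln (n.+2%:R / - ln q * (L0 + 1 + ln n.+2%:R)).
  by rewrite [X in _ <= X]lnM ?posrE ?divr_gt0// [ln (_ / - ln q)]ln_div ?posrE//; lra.
have nL0 : 0 < n.+2%:R / - ln q by rewrite divr_gt0.
rewrite ler_ln ?posrE; [|exact: addr_gt0|exact: mulr_gt0].
(* The summand 1 of [1 + n / a] is absorbed through [L <= L0 <= n L0]. *)
have h1 : 1 <= n.+2%:R / - ln q * L0.
  rewrite mulrAC ler_pdivlMr// mul1r (le_trans qL)// ler_peMl ?(le_trans ler01)//.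
  by rewrite ler1n.
have h2 : n.+2%:R / a <= n.+2%:R / - ln q * (1 + ln n.+2%:R).
  rewrite -mulrA ler_pM2l// mulrC ler_pdivlMr// mulrC ler_pdivrMr//.
  have := ratio_prod_lb n a (ltW a0); rewrite aq mulrC => /le_trans; apply.
  by rewrite ler_pM2r// lerD2l.
by apply: (le_trans (lerD h1 h2)); rewrite -mulrDr addrA.
Qed.

(** At [n = 2], [ln (n - 1)] vanishes and [approxA] is constantly 1. From [n = 3] on,
    [ln (n - 1) >= 1 / 2], so [ln (ln (n - 1)) >= - ln 2 >= - L0]. *)
Lemma approxA_bounds n (q L0 : R) : (3 <= n)%N -> 0 < q < 1 -> - ln q <= L0 -> 1 <= L0 ->
  gap n q - L0 <= approxA rho n q * ln rho <=
  gap n q + ln rho + ln (L0 + 1 + ln n%:R).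
Proof.
case: n => [|[|[|n]]]// _ q01 qL L01; have /andP[q0 q1] := q01.
have L_gt0 : 0 < - ln q by rewrite oppr_gt0 ln_lt0.
rewrite /approxA /logb lnV ?posrE// mulrDl mul1r divfK ?gt_eqF// /gap.
have n0 : 0 < n.+3%:R :> R by rewrite ltr0n.
rewrite -[X in ln (X - 1)]natr1 addrK.
have lnn : ln n.+2%:R <= ln n.+3%:R :> R by rewrite ler_ln ?posrE ?ltr0n// ler_nat.
have half : 2^-1 <= ln n.+2%:R :> R.
  apply: (@le_trans _ _ (ln 2)); last by rewrite ler_ln ?posrE ?ltr0n// ler_nat.
  have := @ln_le_sub1 R 2^-1 ltac:(by rewrite invr_gt0).
  by rewrite lnV ?posrE//; lra.
have lnn0 : 0 < ln n.+2%:R :> R by apply: lt_le_trans half; rewrite invr_gt0.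
have num0 : 0 < n.+3%:R * ln n.+2%:R - ln q :> R by rewrite addr_gt0// mulr_gt0.
rewrite ln_div ?posrE//.
apply/andP; split.
  suff : ln n.+3%:R - 1 <= ln (n.+3%:R * ln n.+2%:R - ln q) by move: ln_rho0; lra.
  have h : - ln 2 <= ln (ln n.+2%:R) :> R.
    by rewrite -lnV ?posrE// ler_ln ?posrE// invr_gt0.
  have h2 : ln 2 <= 1 :> R by have := @ln_le_sub1 R 2 ltac:(by []); lra.
  apply: (@le_trans _ _ (ln (n.+3%:R * ln n.+2%:R))).
    by rewrite lnM ?posrE//; lra.
  by rewrite ler_ln ?posrE ?mulr_gt0// lerDl ltW.
suff : ln (n.+3%:R * ln n.+2%:R - ln q) <= ln n.+3%:R + ln (L0 + 1 + ln n.+3%:R) by lra.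
have K0 : 0 < L0 + 1 + ln n.+3%:R by lra.
rewrite -lnM ?posrE// ler_ln ?posrE ?mulr_gt0//.
rewrite mulrDr addrC lerD ?ler_pM2l//.
apply: (le_trans qL); apply: (@le_trans _ _ (L0 + 1)); first lra.
by rewrite ler_peMl ?ler1n//; lra.
Qed.

Section filter.
Context {I : Type} (F : set_system I) {FF : Filter F} (n : I -> nat) (q : I -> R) (L0 : R).
Hypothesis L01 : 1 <= L0.
Hypothesis qF : \forall u \near F, 0 < q u < 1 /\ - ln (q u) <= L0.
Hypothesis gapF : (fun u => gap (n u) (q u)) @ F --> +oo.

(** All limits with [L] bounded are covered by one filter along which [gap] diverges. As
    [ln L <= L0], [ln n] is at most [gap + L0], which brings the error term to the form required by
    [cvg_log_perturbation]. *)
Let cvg_over_gap (f : nat -> R -> R) k :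
  (k > 0)%N -> (\forall u \near F, (k <= n u)%N) ->
  (forall m (p : R), (k <= m)%N -> 0 < p < 1 -> - ln p <= L0 ->
    gap m p - L0 <= f m p * ln rho <= gap m p + ln rho + ln (L0 + 1 + ln m%:R)) ->
  (fun u => f (n u) (q u) * ln rho / gap (n u) (q u)) @ F --> (1 : R).
Proof.
move=> k0 nF fb; apply: (@cvg_log_perturbation R I F FF _ _ (L0 + 1 + ln rho)) => //.
  by move: L01 ln_rho0; lra.
near=> u.
have [q01 qL] : 0 < q u < 1 /\ - ln (q u) <= L0 by near: u.
have kn : (k <= n u)%N by near: u.
have /andP[f1 f2] := fb _ _ kn q01 qL.
apply/andP; split; first by move: L01 ln_rho0; lra.
apply: (le_trans f2); apply: lerD; first by move: L01 ln_rho0; lra.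
have n0 : 0 <= ln (n u)%:R :> R by rewrite ln_ge0// ler1n (leq_trans k0).
have L_gt0 : 0 < - ln (q u) by rewrite oppr_gt0 ln_lt0.
have lnL : ln (- ln (q u)) <= L0.
  by have := ln_le_sub1 _ L_gt0; lra.
have h : ln (n u)%:R <= gap (n u) (q u) + L0 by rewrite /gap; lra.
have h1 : 0 < L0 + 1 + ln (n u)%:R by move: L01; lra.
have h2 : L0 + 1 + ln (n u)%:R <= gap (n u) (q u) + 2 * (L0 + 1 + ln rho).
  by move: L01 ln_rho0; lra.
by rewrite ler_ln ?posrE//; exact: lt_le_trans h2.
Unshelve. all: by end_near. Qed.

Lemma asym_quantM_approxB : (\forall u \near F, (2 <= n u)%N) ->
  asym_eq F (fun u => quantM X rho (n u) (q u)) (fun u => approxB rho (n u) (q u)).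
Proof.
move=> nF.
have := cvg_over_gap (quantM X rho) 2 isT nF
  (fun m p m2 p01 pL => quantM_bounds m p L0 m2 p01 pL L01).
rewrite /asym_eq; apply: cvg_trans; apply: near_eq_cvg; near=> u.
by rewrite /approxB /logb -mulrBl invf_div -/(gap _ _) mulrA.
Unshelve. all: by end_near. Qed.

(** Both sides are compared with [gap], which is eventually positive and cancels in the quotient. *)
Lemma asym_quantM_approxA : (\forall u \near F, (3 <= n u)%N) ->
  asym_eq F (fun u => quantM X rho (n u) (q u)) (fun u => approxA rho (n u) (q u)).
Proof.
move=> nF.
have nF2 : \forall u \near F, (2 <= n u)%N by apply: filterS nF => u; exact: ltnW.
have hQ := cvg_over_gap (quantM X rho) 2 isT nF2
  (fun m p m2 p01 pL => quantM_bounds m p L0 m2 p01 pL L01).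
have hA := cvg_over_gap (approxA rho) 3 isT nF
  (fun m p m3 p01 pL => approxA_bounds m p L0 m3 p01 pL L01).
have h : (fun u => (quantM X rho (n u) (q u) * ln rho / gap (n u) (q u)) *
    (approxA rho (n u) (q u) * ln rho / gap (n u) (q u))^-1) @ F --> (1 : R).
  rewrite -[X in _ --> X](mulr1 (1 : R)); apply: cvgM; first exact: hQ.
  rewrite -[X in _ --> X](invr1 R); apply: cvgV => //; exact: oner_neq0.
apply: (cvg_trans _ h); apply: near_eq_cvg; near=> u.
have g0 : gap (n u) (q u) != 0.
  by rewrite gt_eqF//; near: u; exact: (cvgry_gt gapF 0).
rewrite /= invf_div -/(gap _ _) mulrA divfK// invfM mulrACA divff ?mulr1// gt_eqF//.
Unshelve. all: by end_near. Qed.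

End filter.

(** With [n] fixed, both sides are 1 plus a term of order [1 / L], by [ln (1 + x) <= x]. Since
    [approxB] tends to minus infinity here, only the first equivalence survives. *)
Lemma asym_quantM_right0 n : (2 <= n)%N ->
  asym_eq (0 : R)^'+ (quantM X rho n) (approxA rho n).
Proof.
case: n => [|[|n]]// _; have n0 : 0 < n.+2%:R :> R by rewrite ltr0n.
have hQ : quantM X rho n.+2 q @[q --> 0^'+] --> (1 : R).
  apply: (@cvg_right0_ln _ _ (n.+2%:R * (1 + ln n.+1%:R) / ln rho)) => q q01.
  have L_gt0 : 0 < - ln q by rewrite oppr_gt0 ln_lt0.
  have [a a0 aq] := ratio_prod_surj n q q01.
  rewrite (quantME _ _ lam _ lam0 rho1 iidX _ _ _ a0 aq).
  have na0 : 0 < n.+2%:R / a by rewrite divr_gt0.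
  apply/andP; split.
    by rewrite lerDl divr_ge0 ?(ltW ln_rho0)// ln_ge0// lerDl ltW.
  rewrite lerD2l.
  rewrite mulrAC ler_pM2r ?invr_gt0//.
  apply: (@le_trans _ _ (n.+2%:R / a)).
    by have := ln_le_sub1 (1 + n.+2%:R / a) (addr_gt0 ltr01 na0); lra.
  rewrite -mulrA ler_pM2l// ler_pdivlMr// mulrC ler_pdivrMr//.
  by have := ratio_prod_lb n a (ltW a0); rewrite aq mulrC.
have hA : approxA rho n.+2 q @[q --> 0^'+] --> (1 : R).
  apply: (@cvg_right0_ln _ _ (n.+2%:R * ln n.+1%:R / ln rho)) => q q01.
  have L_gt0 : 0 < - ln q by rewrite oppr_gt0 ln_lt0.
  have /andP[q0 _] := q01.
  have c0 : 0 <= n.+2%:R * ln n.+1%:R / - ln q :> R.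
    by rewrite divr_ge0 ?(ltW L_gt0)// mulr_ge0 ?ln_ge0 ?ler1n.
  have -> : approxA rho n.+2 q = 1 + ln (1 + n.+2%:R * ln n.+1%:R / - ln q) / ln rho.
    rewrite /approxA /logb lnV ?posrE// -[X in ln (X - 1)]natr1 addrK addrC.
    by rewrite [in LHS]mulrDl divff ?gt_eqF// [_ / - ln q + 1]addrC.
  apply/andP; split.
    by rewrite lerDl divr_ge0 ?(ltW ln_rho0)// ln_ge0// lerDl.
  rewrite lerD2l.
  rewrite [leRHS]mulrAC ler_pM2r ?invr_gt0//.
  have c1 : 0 < 1 + n.+2%:R * ln n.+1%:R / - ln q :> R by rewrite ltr_pwDl.
  by have := ln_le_sub1 _ c1; lra.
rewrite /asym_eq -[X in _ --> X](mulr1 (1 : R)); apply: cvgM; first exact: hQ.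
rewrite -[X in _ --> X](invr1 R); apply: cvgV => //; exact: oner_neq0.
Qed.

End quantile_asymptotics.

Theorem theorem1 (R : realType) (d : measure_display) (T : measurableType d)
  (P : probability T R) (X : nat -> {RV P >-> R}) (lam rho : R) :
  0 < lam -> 1 < rho -> iid_exp X lam ->
  [/\
   (* CDF *)
   forall (n : nat) (m : R), (2 <= n)%N -> 1 < m ->
     cdfM X rho n m =
     (n%:R - 1) * Beta ((rho `^ (m - 1) + n%:R - 1) / (rho `^ (m - 1) - 1))
                       (n%:R - 1),
   (* density = derivative of the CDF *)
   forall (n : nat) (m : R), (2 <= n)%N -> 1 < m ->
     derivable (cdfM X rho n) m 1 /\
     derive1 (cdfM X rho n) m =
     n%:R * rho `^ (m - 1) * cdfM X rho n m * ln rho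
       / (rho `^ (m - 1) - 1) ^+ 2
     * (digamma (n%:R * rho `^ (m - 1) / (rho `^ (m - 1) - 1))
        - digamma ((rho `^ (m - 1) + n%:R - 1) / (rho `^ (m - 1) - 1))) &
   [/\
   (* n -> oo, q fixed *)
   forall q : R, 0 < q < 1 ->
     asym_eq \oo (fun n => quantM X rho n q) (fun n => approxA rho n q) /\
     asym_eq \oo (fun n => quantM X rho n q) (fun n => approxB rho n q),
   (* q -> 1^-, n fixed *)
   (forall n : nat, (3 <= n)%N ->
     asym_eq (1 : R)^'- (quantM X rho n) (approxA rho n)) /\
   (forall n : nat, (2 <= n)%N ->
     asym_eq (1 : R)^'- (quantM X rho n) (approxB rho n)),
   (* n -> oo and q -> 1^- jointly *)
   asym_eq (filter_prod \oo (1 : R)^'-)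
       (fun p : nat * R => quantM X rho p.1 p.2)
       (fun p => approxA rho p.1 p.2) /\
   asym_eq (filter_prod \oo (1 : R)^'-)
       (fun p : nat * R => quantM X rho p.1 p.2)
       (fun p => approxB rho p.1 p.2) &
   (* q -> 0^+, n fixed : first equivalence *)
   forall n : nat, (2 <= n)%N ->
     asym_eq (0 : R)^'+ (quantM X rho n) (approxA rho n)]].
Proof.
move=> lam0 rho1 iidX; split.
- by move=> n m n2 m1; exact: (cdfM_Beta P X lam).
- move=> n m n2 m1.
  have [dF F'] := is_derive_cdfM P X lam rho lam0 rho1 iidX n m n2 m1.
  by split=> //; rewrite derive1E.
split.
- move=> q q01; have /andP[q0 q1] := q01.
  (* Here [L] is constant but possibly large; in the limits at [1^-] the bound [L0 = 1] suffices. *)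
  pose L0 := Num.max 1 (- ln q).
  have L01 : 1 <= L0 by rewrite le_max lexx.
  have qF : \forall _ \near \oo, 0 < q < 1 /\ - ln q <= L0.
    by apply: nearW => _; rewrite le_max lexx orbT.
  have gF : (fun n : nat => ln n%:R - ln (- ln q)) @ \oo --> +oo.
    apply/cvgryPge => A; near=> n; rewrite lerBrDr; near: n; exact: near_infty_ln.
  split.
  + by apply: (asym_quantM_approxA P X lam rho lam0 rho1 iidX \oo id _ L0) => //;
      exact: nbhs_infty_ge.
  + by apply: (asym_quantM_approxB P X lam rho lam0 rho1 iidX \oo id _ L0) => //;
      exact: nbhs_infty_ge.
- have gF (n : nat) : (fun q : R => ln n%:R - ln (- ln q)) @ (1 : R)^'- --> +oo.
    apply/cvgryPge => A; near=> q.
    have [q01 qL] : 0 < q < 1 /\ - ln q <= expR (ln n%:R - A).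
      by near: q; apply: near_left1_ln; exact: expR_gt0.
    have L_gt0 : 0 < - ln q by rewrite oppr_gt0 ln_lt0.
    by rewrite lerBrDl -lerBrDr -ler_expR lnK ?posrE.
  have qF := near_left1_ln 1 (@ltr01 R).
  split => n n2.
  + by apply: (asym_quantM_approxA P X lam rho lam0 rho1 iidX _ (fun=> n) id 1) => //;
      exact: nearW.
  + by apply: (asym_quantM_approxB P X lam rho lam0 rho1 iidX _ (fun=> n) id 1) => //;
      exact: nearW.
- have nF k : \forall p \near filter_prod \oo (1 : R)^'-, (k <= p.1)%N.
    exact: (cvg_fst (nbhs_infty_ge k)).
  have qF : \forall p \near filter_prod \oo (1 : R)^'-, 0 < p.2 < 1 /\ - ln p.2 <= 1.
    exact: (cvg_snd (near_left1_ln 1 (@ltr01 R))).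
  have gF : (fun p : nat * R => ln p.1%:R - ln (- ln p.2)) @ filter_prod \oo (1 : R)^'- --> +oo.
    apply/cvgryPge => A; near=> p.
    have h : A <= ln p.1%:R by near: p; exact: (cvg_fst (near_infty_ln A)).
    have [q01 qL] : 0 < p.2 < 1 /\ - ln p.2 <= 1 by near: p.
    have L_gt0 : 0 < - ln p.2 by rewrite oppr_gt0 ln_lt0.
    (* Once [L <= 1], the term [- ln L] is nonnegative, so [ln n] alone makes [gap] diverge. *)
    by apply: (le_trans h); rewrite lerDl oppr_ge0 ln_le0.
  split.
  + by apply: (asym_quantM_approxA P X lam rho lam0 rho1 iidX _ fst snd 1).
  + by apply: (asym_quantM_approxB P X lam rho lam0 rho1 iidX _ fst snd 1).
- by move=> n n2; exact: (asym_quantM_right0 P X lam).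
Unshelve. all: by end_near. Qed.
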